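(* Let $u,e\in C_6$ be two unitary elements. Then there is a Jordan $*$-automorphism $T:C_6\to C_6$ such that (i) $T(e)$ is a diagonal matrix; (ii) the entries of $T(u)$ are biquaternions.
   Context: Cayley–Dickson algebras: $\mathcal A_0=\mathbb C$ with its usual product, $x^{\diamond}=x$, $x^*=\overline{x}$. Inductively $\mathcal A_{n+1}=\mathcal A_n\times\mathcal A_n$ with $\overline{(x_1,x_2)}=(\overline{x_1},\overline{x_2})$, $(x_1,x_2)^{\diamond}=(x_1^{\diamond},-x_2)$, $(x_1,x_2)^*=(x_1^*,-\overline{x_2})$ and $(x_1,x_2)\boxdot(y_1,y_2)=(x_1\boxdot y_1-y_2\boxdot x_2^{\diamond},\ x_1^{\diamond}\boxdot y_2+y_1\boxdot x_2)$. Biquaternions: $\mathbb H_C=\mathcal A_2$; complex octonions: $\mathbb O=\mathcal A_3$; $a\in\mathcal A_n$ is identified with $(a,0)\in\mathcal A_{n+1}$, so $\mathbb H_C\subset\mathbb O$. For matrices over $\mathbb O$: $(x^\diamond)_{ij}=(x_{ji})^\diamond$, $(x^* )_{ij}=(x_{ji})^*$, and $\boxdot$ is the usual matrix product. The Cartan factor of type 6 is the JB$^*$-algebra $C_6=H_3(\mathbb O)=\{x\in M_3(\mathbb O): x^{\diamond}=x\}$ with Jordan product $x\circ y=\frac12(x\boxdot y+y\boxdot x)$ and involution $^*$. It has the triple product $\{x,y,z\}=(x\circ y^* )\circ z+(z\circ y^* )\circ x-(x\circ z)\circ y^*$. An element $u\in C_6$ is unitary if $\{u,u,x\}=x$ for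 all $x\in C_6$. A Jordan $*$-automorphism is a complex-linear bijection preserving $\circ$ and $^*$. *)

(* Defs.v *)
From HB Require Import structures.
From mathcomp Require Import all_boot all_order all_algebra.
From mathcomp Require Import complex reals.

Set Implicit Arguments.
Unset Strict Implicit.
Unset Printing Implicit Defensive.

Import Order.TTheory GRing.Theory Num.Theory.

Local Open Scope ring_scope.
Local Open Scope complex_scope.

(* The complex Cayley-Dickson algebras A_n, as complex vector spaces: the
   addition and the scaling are componentwise, and A_0 = C. *)
Fixpoint CD (R : realType) (n : nat) : lmodType R[i] :=
  if n is m.+1 then (CD R m * CD R m)%type else R[i]^o.

(* Entrywise complex conjugation x |-> \overline{x} *)
Fixpoint cdconj (R : realType) (n : nat) : CD R n -> CD R n :=
  match n return CD R n -> CD R n with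
  | 0 => fun x => conjc x
  | m.+1 => fun x => (cdconj x.1, cdconj x.2)
  end.

(* The linear involution x |-> x^\diamond *)
Fixpoint cddiam (R : realType) (n : nat) : CD R n -> CD R n :=
  match n return CD R n -> CD R n with
  | 0 => fun x => x
  | m.+1 => fun x => (cddiam x.1, - x.2)
  end.

(* The conjugate-linear involution x |-> x^* *)
Fixpoint cdstar (R : realType) (n : nat) : CD R n -> CD R n :=
  match n return CD R n -> CD R n with
  | 0 => fun x => conjc x
  | m.+1 => fun x => (cdstar x.1, - cdconj x.2)
  end.

(* The (neither commutative nor associative, in general) product of A_n *)
Fixpoint cdmul (R : realType) (n : nat) : CD R n -> CD R n -> CD R n :=
  match n return CD R n -> CD R n -> CD R n with
  | 0 => fun x y => (x : R[i]) * y
  | m.+1 => fun x y =>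
      (cdmul x.1 y.1 - cdmul y.2 (cddiam x.2),
       cdmul (cddiam x.1) y.2 + cdmul y.1 x.2)
  end.

(* The identification of A_n with a subalgebra of A_{n+1} *)
Definition cdincl (R : realType) (n : nat) (a : CD R n) : CD R n.+1 := (a, 0).

Definition octonion (R : realType) : lmodType R[i] := CD R 3.

Definition is_biquaternion (R : realType) (x : octonion R) : Prop :=
  exists a : CD R 2, x = cdincl a.

(* octonion R is not a ring in the sense of the library, so only the additive
   structure of 'M[octonion R]_3 comes from there: mulmx and *: are replaced
   by omulmx and oscalemx. *)
Section OctonionMatrices.
Variable R : realType.
Implicit Types (c : R[i]) (A B : 'M[octonion R]_3).

Definition odiam A : 'M[octonion R]_3 := \matrix_(i, j) cddiam (A j i).

Definition ostar A : 'M[octonion R]_3 := \matrix_(i, j) cdstar (A j i).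

Definition omulmx A B : 'M[octonion R]_3 :=
  \matrix_(i, j) \sum_k cdmul (A i k) (B k j).

Definition oscalemx c A : 'M[octonion R]_3 := \matrix_(i, j) (c *: A i j).

Definition ojordan A B : 'M[octonion R]_3 :=
  oscalemx 2^-1 (omulmx A B + omulmx B A).

Lemma odiamE A i j : odiam A i j = cddiam (A j i).
Proof. by rewrite /odiam; apply: mxE. Qed.

Lemma ostarE A i j : ostar A i j = cdstar (A j i).
Proof. by rewrite /ostar; apply: mxE. Qed.

Lemma omulmxE A B i j : omulmx A B i j = \sum_k cdmul (A i k) (B k j).
Proof. by rewrite /omulmx; apply: mxE. Qed.

Lemma oscalemxE c A i j : oscalemx c A i j = c *: A i j.
Proof. by rewrite /oscalemx; apply: mxE. Qed.

Lemma omx0 i j : (0 : 'M[octonion R]_3) i j = 0.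
Proof. exact: mxE. Qed.

Lemma omxD A B i j : (A + B) i j = A i j + B i j.
Proof. exact: mxE. Qed.

Lemma omxB A B i j : (A - B) i j = A i j - B i j.
Proof. by rewrite omxD; congr (_ + _); apply: mxE. Qed.

Lemma ojordanE A B i j :
  ojordan A B i j = 2^-1 *: (\sum_k cdmul (A i k) (B k j)
                             + \sum_k cdmul (B i k) (A k j)).
Proof. by rewrite /ojordan oscalemxE omxD !omulmxE. Qed.

End OctonionMatrices.

Section CDTheory.
Variable R : realType.

Lemma cdconj0 n : cdconj (0 : CD R n) = 0.
Proof.
elim: n => [|n IHn] /=; first exact: (conjc0 R).
by rewrite IHn.
Qed.

Lemma cdconjN n (x : CD R n) : cdconj (- x) = - cdconj x.
Proof.
elim: n x => [|n IHn] /= x; first exact: (raddfN (@conjc R)).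
by rewrite !IHn.
Qed.

Lemma cddiamD n (x y : CD R n) : cddiam (x + y) = cddiam x + cddiam y.
Proof. by elim: n x y => [|n IHn] //= x y; rewrite IHn opprD. Qed.

Lemma cddiam0 n : cddiam (0 : CD R n) = 0.
Proof. by elim: n => [|n IHn] //=; rewrite IHn oppr0. Qed.

Lemma cddiamN n (x : CD R n) : cddiam (- x) = - cddiam x.
Proof. by elim: n x => [|n IHn] //= x; rewrite IHn. Qed.

Lemma cddiamZ n (c : R[i]) (x : CD R n) : cddiam (c *: x) = c *: cddiam x.
Proof. by elim: n x => [|n IHn] //= x; rewrite IHn -scalerN. Qed.

Lemma cddiam_sum n I (r : seq I) (F : I -> CD R n) :
  cddiam (\sum_(i <- r) F i) = \sum_(i <- r) cddiam (F i).
Proof. exact: (big_morph (@cddiam R n) (@cddiamD n) (@cddiam0 n)). Qed.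

Lemma cddiamK n : involutive (@cddiam R n).
Proof. by elim: n => [|n IHn] //= [x y] /=; rewrite IHn opprK. Qed.

Lemma cdmulNl n (x y : CD R n) : cdmul (- x) y = - cdmul x y
with cdmulNr n (x y : CD R n) : cdmul x (- y) = - cdmul x y.
Proof.
- case: n x y => [|n] /= x y; first exact: mulNr.
  by rewrite !cddiamN !cdmulNl !cdmulNr -!opprD.
- case: n x y => [|n] /= x y; first exact: mulrN.
  by rewrite !cdmulNl !cdmulNr -!opprD.
Qed.

Lemma cddiamM n (x y : CD R n) :
  cddiam (cdmul x y) = cdmul (cddiam y) (cddiam x).
Proof.
elim: n x y => [|n IHn] /= x y; first exact: mulrC.
rewrite cddiamD cddiamN !IHn !cddiamK !cddiamN !cdmulNl !cdmulNr.
by rewrite opprK opprD [- cdmul _ _ - _]addrC.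
Qed.

Lemma cddiam_star n (x : CD R n) : cddiam (cdstar x) = cdstar (cddiam x).
Proof. by elim: n x => [|n IHn] //= x; rewrite IHn cdconjN. Qed.

End CDTheory.

(* The Cartan factor C_6 = H_3(O) *)
Record C6 (R : realType) := MkC6 {
  c6mx :> 'M[octonion R]_3;
  _ : odiam c6mx == c6mx
}.

HB.instance Definition _ (R : realType) := [isSub for @c6mx R].
HB.instance Definition _ (R : realType) := [Choice of C6 R by <:].

Section C6Structure.
Variable R : realType.
Implicit Types (c : R[i]) (x y z : C6 R).

Definition c6_pred : {pred 'M[octonion R]_3} := fun A => odiam A == A.

Lemma c6_zmod_closed : zmod_closed c6_pred.
Proof.
split.
  by apply/eqP/matrixP=> i j; rewrite odiamE !omx0 cddiam0.
move=> A B /eqP/matrixP hA /eqP/matrixP hB; apply/eqP/matrixP => i j.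
by rewrite odiamE !omxB cddiamD cddiamN -!odiamE hA hB.
Qed.

HB.instance Definition _ := GRing.isZmodClosed.Build _ c6_pred c6_zmod_closed.
HB.instance Definition _ :=
  GRing.SubChoice_isSubZmodule.Build _ c6_pred (C6 R) c6_zmod_closed.

Lemma c6P x y : (forall i j, c6mx x i j = c6mx y i j) -> x = y.
Proof. by move=> eq_xy; apply/val_inj/matrixP. Qed.

Lemma c6D x y : c6mx (x + y) = c6mx x + c6mx y.
Proof. exact: (raddfD (val : C6 R -> 'M[octonion R]_3)). Qed.

Lemma cddiam_c6 x i j : cddiam (c6mx x j i) = c6mx x i j.
Proof. by have /eqP/matrixP/(_ i j) := valP x; rewrite odiamE. Qed.

Lemma c6_scale_subproof c x : odiam (oscalemx c x) == oscalemx c x.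
Proof.
by apply/eqP/matrixP => i j; rewrite odiamE !oscalemxE cddiamZ cddiam_c6.
Qed.

Definition c6scale c x : C6 R := MkC6 (c6_scale_subproof c x).

Lemma c6scaleE c x i j : c6mx (c6scale c x) i j = c *: c6mx x i j.
Proof. exact: oscalemxE. Qed.

Fact c6scaleA c1 c2 x : c6scale c1 (c6scale c2 x) = c6scale (c1 * c2) x.
Proof.
apply: c6P => i j; rewrite [RHS]c6scaleE [LHS]c6scaleE.
by rewrite [X in _ *: X = _]c6scaleE scalerA.
Qed.

Fact c6scale1 : left_id 1 c6scale.
Proof. by move=> x; apply: c6P => i j; rewrite c6scaleE scale1r. Qed.

Fact c6scaleDr : right_distributive c6scale +%R.
Proof.
move=> c x y; apply: c6P => i j.
by rewrite c6scaleE !c6D !omxD scalerDr !c6scaleE.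
Qed.

Fact c6scaleDl x : {morph c6scale^~ x : a b / a + b}.
Proof.
move=> a b; apply: c6P => i j.
rewrite [LHS]c6scaleE scalerDl c6D omxD.
by congr (_ + _); rewrite c6scaleE.
Qed.

HB.instance Definition _ := GRing.Zmodule_isLmodule.Build R[i] (C6 R)
  c6scaleA c6scale1 c6scaleDr c6scaleDl.

Lemma c6_jordan_subproof x y : odiam (ojordan x y) == ojordan x y.
Proof.
apply/eqP/matrixP => i j.
rewrite odiamE !ojordanE cddiamZ cddiamD !cddiam_sum addrC.
congr (_ *: (_ + _)); apply: eq_bigr => k _.
  by rewrite cddiamM !cddiam_c6.
by rewrite cddiamM !cddiam_c6.
Qed.

Definition c6jordan x y : C6 R := MkC6 (c6_jordan_subproof x y).

Lemma c6_star_subproof x : odiam (ostar x) == ostar x.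
Proof.
by apply/eqP/matrixP => i j; rewrite odiamE !ostarE cddiam_star cddiam_c6.
Qed.

Definition c6star x : C6 R := MkC6 (c6_star_subproof x).

Definition c6triple x y z : C6 R :=
  c6jordan (c6jordan x (c6star y)) z + c6jordan (c6jordan z (c6star y)) x
  - c6jordan (c6jordan x z) (c6star y).

Definition c6unitary (u : C6 R) : Prop := forall x, c6triple u u x = x.

Definition jordan_star_automorphism (T : C6 R -> C6 R) : Prop :=
  [/\ linear T, bijective T,
      {morph T : x y / c6jordan x y}
    & {morph T : x / c6star x}].

End C6Structure.

(* Main.v *)
(* The automorphisms used come from two sources: conjugation by a real
   orthogonal matrix, and, for a real unit octonion a, the map [spin a] acting
   on the entries (1,2), (2,3), (1,3) by x |-> a x, x a, a x a, which is a
   Jordan *-automorphism by the Moufang identities and fixes the diagonal.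

   A few steps of spin type make the first row of a real element scalar.
   Tridiagonalizing by a rotation and repeating this makes the whole element
   a real matrix, to which the spectral theorem applies: real elements are
   diagonalizable.  A unitary u is a + i b with a, b real; unitarity forces
   [L_a, L_b] = 0, hence a and b are simultaneously diagonalizable.  So e is
   taken to a diagonal matrix, and u is a polynomial of degree 2 in a single
   real element h.  It remains to move h into H_3(H) by automorphisms
   preserving diagonal matrices: after its first row is made scalar only one
   octonion entry w is left, and two further spins suffice. *)
From HB Require Import structures.
Require Import Defs.
From mathcomp Require Import all_boot all_order all_algebra.
From mathcomp Require Import fingroup perm complex reals polyrcf ring.

Set Implicit Arguments.
Unset Strict Implicit.
Unset Printing Implicit Defensive.

Import Order.TTheory GRing.Theory Num.Theory.

Local Open Scope ring_scope.
Local Open Scope complex_scope.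

(** * Cayley-Dickson algebras and octonions *)

Section CayleyDickson.
Variable R : realType.
Implicit Types (n : nat) (c : R[i]).

(** The product of A_{n+1} puts factors of its right argument on both sides, so each distributive
    law at level n+1 uses both at level n. Hence the mutual recursion on [n], which also serves for
    scaling and for [cdnm]. *)
Lemma cdmulDr n (x y z : CD R n) : cdmul x (y + z) = cdmul x y + cdmul x z
with cdmulDl n (x y z : CD R n) : cdmul (y + z) x = cdmul y x + cdmul z x.
Proof.
- case: n x y z => [|n] /= x y z; first exact: mulrDr.
  rewrite !cdmulDr !cdmulDl.
  by congr (_, _); rewrite ?opprD addrACA.
- case: n x y z => [|n] /= x y z; first exact: mulrDl.
  rewrite !(cddiamD, opprD) !cdmulDr !cdmulDl.
  by congr (_, _); rewrite ?opprD addrACA.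
Qed.

Lemma cdmulZr n c (x y : CD R n) : cdmul x (c *: y) = c *: cdmul x y
with cdmulZl n c (x y : CD R n) : cdmul (c *: x) y = c *: cdmul x y.
Proof.
- case: n x y => [|n] /= x y; first exact: (mulrCA x c y).
  by rewrite !cdmulZr !cdmulZl -scalerBr -scalerDr.
- case: n x y => [|n] /= x y; first exact: (esym (mulrA c x y)).
  by rewrite -?scalerN !cddiamZ !cdmulZr !cdmulZl -scalerBr -scalerDr.
Qed.

Lemma cdmul0r n (x : CD R n) : cdmul x 0 = 0.
Proof. by rewrite -(scale0r (0 : CD R n)) cdmulZr !scale0r. Qed.

Lemma cdmul0l n (x : CD R n) : cdmul 0 x = 0.
Proof. by rewrite -(scale0r (0 : CD R n)) cdmulZl !scale0r. Qed.

Lemma cdmul_suml n I (r : seq I) (F : I -> CD R n) x :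
  cdmul (\sum_(i <- r) F i) x = \sum_(i <- r) cdmul (F i) x.
Proof.
exact: (big_morph (fun y => cdmul y x) (cdmulDl x) (cdmul0l x)).
Qed.

Lemma cdmul_sumr n I (r : seq I) (F : I -> CD R n) x :
  cdmul x (\sum_(i <- r) F i) = \sum_(i <- r) cdmul x (F i).
Proof. exact: (big_morph (cdmul x) (cdmulDr x) (cdmul0r x)). Qed.

Fixpoint cd1 n : CD R n :=
  match n return CD R n with 0 => (1 : R[i]) | m.+1 => (cd1 m, 0) end.

Lemma cddiam1 n : cddiam (cd1 n) = cd1 n.
Proof. by elim: n => [|n IHn] //=; rewrite IHn oppr0. Qed.

Lemma cdmul1l n (x : CD R n) : cdmul (cd1 n) x = x.
Proof.
elim: n x => [|n IHn] /= x; first exact: mul1r.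
by rewrite cddiam0 !cdmul0r cddiam1 !IHn subr0 addr0; case: x.
Qed.

Lemma cdmul1r n (x : CD R n) : cdmul x (cd1 n) = x.
Proof.
elim: n x => [|n IHn] /= x; first exact: mulr1.
by rewrite cdmul0l cdmul0r !IHn cdmul1l subr0 add0r; case: x.
Qed.

Lemma cd1_neq0 n : cd1 n != 0.
Proof. by elim: n => [|n IHn] /=; [exact: oner_neq0|rewrite xpair_eqE (negPf IHn)]. Qed.

(** At each doubling the new component satisfies y = -y and vanishes. Applied to diagonal entries of
    elements of C_6, this makes them complex scalars. *)
Lemma cddiam_fixed n (x : CD R n) : cddiam x = x -> exists c, x = c *: cd1 n.
Proof.
elim: n x => [|n IHn] /= x; first by exists x; rewrite -[LHS]mulr1.
case: x => x y /= [/IHn[c ->] y0]; exists c; congr (_, _).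
rewrite scaler0; apply/eqP; move/esym/eqP: y0.
by rewrite -addr_eq0 -mulr2n -scaler_nat scaler_eq0 pnatr_eq0.
Qed.

Lemma cdconjD n (x y : CD R n) : cdconj (x + y) = cdconj x + cdconj y.
Proof.
elim: n x y => [|n IHn] /= x y; first exact: (raddfD (@conjc R)).
by rewrite !IHn.
Qed.

Lemma cdconjZ n c (x : CD R n) : cdconj (c *: x) = conjc c *: cdconj x.
Proof.
elim: n x => [|n IHn] /= x; first exact: (rmorphM (@conjc R)).
by rewrite !IHn.
Qed.

Lemma cdconjK n (x : CD R n) : cdconj (cdconj x) = x.
Proof. by elim: n x => [|n IHn] x /=; [exact: conjcK | rewrite !IHn; case: x]. Qed.

Lemma cdconj1 n : cdconj (cd1 n) = cd1 n.
Proof.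
by elim: n => [|n IHn] /=; [exact: (conjc1 R) | rewrite IHn cdconj0].
Qed.

Lemma cdconj_diam n (x : CD R n) : cdconj (cddiam x) = cddiam (cdconj x).
Proof. by elim: n x => [|n IHn] //= x; rewrite IHn cdconjN. Qed.

Lemma cdstarE n (x : CD R n) : cdstar x = cdconj (cddiam x).
Proof. by elim: n x => [|n IHn] //= x; rewrite IHn cdconjN. Qed.

Lemma cdconjM n (x y : CD R n) :
  cdconj (cdmul x y) = cdmul (cdconj x) (cdconj y).
Proof.
elim: n x y => [|n IHn] /= x y; first exact: (rmorphM (@conjc R)).
by rewrite !cdconjD cdconjN !IHn !cdconj_diam.
Qed.

(** The complex quadratic form given by the sum of squares of all coordinates, without conjugation.
    It has nonzero isotropic vectors in general, but is the squared Euclidean norm on real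
    elements. *)
Fixpoint cdnm n : CD R n -> R[i] :=
  match n return CD R n -> R[i] with
  | 0 => fun x => x * x
  | m.+1 => fun x => cdnm x.1 + cdnm x.2
  end.

Lemma cdnm_diam n (x : CD R n) : cdnm (cddiam x) = cdnm x.
Proof.
have nmN m (y : CD R m) : cdnm (- y) = cdnm y.
  elim: m y => [|m IHm] /= y; first exact: mulrNN.
  by rewrite !IHm.
by elim: n x => [|n IHn] //= x; rewrite IHn nmN.
Qed.

Lemma cdnmZ n c (x : CD R n) : cdnm (c *: x) = c * c * cdnm x.
Proof.
elim: n x => [|n IHn] /= x; first exact: (mulrACA c x c x).
by rewrite !IHn mulrDr.
Qed.

Lemma cdmul_diamr n (x : CD R n) : cdmul x (cddiam x) = cdnm x *: cd1 n
with cdmul_diaml n (x : CD R n) : cdmul (cddiam x) x = cdnm x *: cd1 n.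
Proof.
- case: n x => [|n] /= x; first by rewrite -[RHS]/(_ * 1) mulr1.
  rewrite cdmulNl cdmulNr opprK !cdmul_diamr addNr.
  by rewrite -scalerDl; congr (_, _); rewrite scaler0.
- case: n x => [|n] /= x; first by rewrite -[RHS]/(_ * 1) mulr1.
  rewrite cddiamK cddiamN !cdmulNr opprK cdmul_diaml cdmul_diamr subrr.
  by rewrite -scalerDl; congr (_, _); rewrite scaler0.
Qed.

(** Polarization of x x^⋄ = [cdnm x]. The symmetrised products on the diagonal of a Jordan product
    thus depend only on the quadratic form. *)
Lemma cdmul_diam_polar n (x y : CD R n) :
  cdmul x (cddiam y) + cdmul y (cddiam x) =
  (cdnm (x + y) - cdnm x - cdnm y) *: cd1 n.
Proof.
rewrite !scalerBl -!cdmul_diamr cddiamD cdmulDl !cdmulDr.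
by rewrite -(addrA (cdmul x _)) [X in X - _ - _]addrC addrK addrA addrK.
Qed.

Lemma sqr_real_ge0 (z : R[i]) : conjc z = z -> 0 <= z * z.
Proof.
case: z => a b [/eqP]; rewrite eq_sym -addr_eq0 -mulr2n mulrn_eq0 /= => /eqP ->.
by rewrite lecE /= !mulr0 !mul0r addr0 subr0 eqxx -expr2 sqr_ge0.
Qed.

Lemma cdnm_ge0 n (x : CD R n) : cdconj x = x -> 0 <= cdnm x.
Proof.
elim: n x => [|n IHn] /= x; first exact: sqr_real_ge0.
by case: x => x y [hx hy] /=; rewrite addr_ge0 ?IHn.
Qed.

Lemma cdnm_eq0 n (x : CD R n) : cdconj x = x -> cdnm x = 0 -> x = 0.
Proof.
elim: n x => [|n IHn] /= x.
  by move=> _ /eqP; rewrite mulf_eq0 orbb => /eqP.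
case: x => x y [hx hy] /= /eqP; rewrite paddr_eq0 ?cdnm_ge0 //.
by case/andP=> /eqP /(IHn _ hx) -> /eqP /(IHn _ hy) ->.
Qed.

Lemma cdnm_sqr n (x : CD R n) : cdconj x = x -> x <> 0 ->
  exists r : R, r != 0 /\ cdnm x = (r * r)%:C.
Proof.
move=> hx x0; have := cdnm_ge0 hx; have : cdnm x != 0.
  by apply/eqP => /(cdnm_eq0 hx).
case: (cdnm x) => a b nz; rewrite lecE /= => /andP[/eqP b0 a0].
exists (Num.sqrt a); rewrite -expr2 sqr_sqrtr // b0; split=> //.
rewrite sqrtr_eq0 -ltNge lt_neqAle a0 andbT eq_sym.
by apply: contraNneq nz => ->; rewrite b0.
Qed.

End CayleyDickson.

(** * Octonion identities: alternativity, composition, Moufang *)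

Section OctonionIdentities.
Variable R : realType.

Section Octonions.
Implicit Types (a x y : CD R 3).

Definition oct8 (x0 x1 x2 x3 x4 x5 x6 x7 : R[i]) : CD R 3 :=
  (((x0, x1), (x2, x3)), ((x4, x5), (x6, x7))).

Lemma oct8P x : exists x0 x1 x2 x3 x4 x5 x6 x7 : R[i],
  x = oct8 x0 x1 x2 x3 x4 x5 x6 x7.
Proof.
by case: x => [[[x0 x1] [x2 x3]] [[x4 x5] [x6 x7]]];
  exists x0, x1, x2, x3, x4, x5, x6, x7.
Qed.

Lemma oct8Z (c x0 x1 x2 x3 x4 x5 x6 x7 : R[i]) :
  c *: oct8 x0 x1 x2 x3 x4 x5 x6 x7 =
  oct8 (c * x0) (c * x1) (c * x2) (c * x3) (c * x4) (c * x5) (c * x6) (c * x7).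
Proof. by []. Qed.

Lemma oct8_diam (x0 x1 x2 x3 x4 x5 x6 x7 : R[i]) :
  cddiam (oct8 x0 x1 x2 x3 x4 x5 x6 x7) =
  oct8 x0 (- x1) (- x2) (- x3) (- x4) (- x5) (- x6) (- x7).
Proof. by []. Qed.

Lemma oct8_nm (x0 x1 x2 x3 x4 x5 x6 x7 : R[i]) :
  cdnm (oct8 x0 x1 x2 x3 x4 x5 x6 x7) =
  x0 * x0 + x1 * x1 + (x2 * x2 + x3 * x3) +
  (x4 * x4 + x5 * x5 + (x6 * x6 + x7 * x7)).
Proof. by []. Qed.

(** The octonion multiplication table. With it the alternative, composition and Moufang laws become
    polynomial identities in the coordinates, settled by [ring]. *)
Lemma oct8M (x0 x1 x2 x3 x4 x5 x6 x7 y0 y1 y2 y3 y4 y5 y6 y7 : R[i]) :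
  cdmul (oct8 x0 x1 x2 x3 x4 x5 x6 x7) (oct8 y0 y1 y2 y3 y4 y5 y6 y7) =
  oct8
    (x0 * y0 - x1 * y1 - x2 * y2 - x3 * y3
      - x4 * y4 - x5 * y5 - x6 * y6 - x7 * y7)
    (x0 * y1 + x1 * y0 + x3 * y2 + x5 * y4
      + x6 * y7 - x2 * y3 - x4 * y5 - x7 * y6)
    (x0 * y2 + x1 * y3 + x2 * y0 + x6 * y4
      + x7 * y5 - x3 * y1 - x4 * y6 - x5 * y7)
    (x0 * y3 + x2 * y1 + x3 * y0 + x5 * y6
      + x7 * y4 - x1 * y2 - x4 * y7 - x6 * y5)
    (x0 * y4 + x1 * y5 + x2 * y6 + x3 * y7
      + x4 * y0 - x5 * y1 - x6 * y2 - x7 * y3)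
    (x0 * y5 + x2 * y7 + x4 * y1 + x5 * y0
      + x6 * y3 - x1 * y4 - x3 * y6 - x7 * y2)
    (x0 * y6 + x3 * y5 + x4 * y2 + x6 * y0
      + x7 * y1 - x1 * y7 - x2 * y4 - x5 * y3)
    (x0 * y7 + x1 * y6 + x4 * y3 + x5 * y2
      + x7 * y0 - x2 * y5 - x3 * y4 - x6 * y1).
Proof.
rewrite /oct8 /=.
by congr (((_, _), (_, _)), ((_, _), (_, _))) => /=; ring.
Qed.

(** The alternative law in metric form: multiplication by an element of norm one is inverted by its
    conjugate, although the product is not associative. *)
Lemma octonion_mulKV a x : cdmul (cddiam a) (cdmul a x) = cdnm a *: x.
Proof.
have [a0 [a1 [a2 [a3 [a4 [a5 [a6 [a7 ->]]]]]]]] := oct8P a.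
have [x0 [x1 [x2 [x3 [x4 [x5 [x6 [x7 ->]]]]]]]] := oct8P x.
rewrite oct8_diam !oct8M oct8_nm oct8Z; congr oct8; ring.
Qed.

Lemma octonion_mulK a x : cdmul a (cdmul (cddiam a) x) = cdnm a *: x.
Proof. by rewrite -{1}[a]cddiamK octonion_mulKV cdnm_diam. Qed.

Lemma octonion_nmM a x : cdnm (cdmul a x) = cdnm a * cdnm x.
Proof.
have [a0 [a1 [a2 [a3 [a4 [a5 [a6 [a7 ->]]]]]]]] := oct8P a.
have [x0 [x1 [x2 [x3 [x4 [x5 [x6 [x7 ->]]]]]]]] := oct8P x.
rewrite oct8M !oct8_nm; ring.
Qed.

Lemma moufang_left a x y :
  cdmul (cdmul a (cdmul x a)) y = cdmul a (cdmul x (cdmul a y)).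
Proof.
have [a0 [a1 [a2 [a3 [a4 [a5 [a6 [a7 ->]]]]]]]] := oct8P a.
have [x0 [x1 [x2 [x3 [x4 [x5 [x6 [x7 ->]]]]]]]] := oct8P x.
have [y0 [y1 [y2 [y3 [y4 [y5 [y6 [y7 ->]]]]]]]] := oct8P y.
rewrite !oct8M; congr oct8; ring.
Qed.

Lemma moufang_middle a x y :
  cdmul (cdmul a x) (cdmul y a) = cdmul a (cdmul (cdmul x y) a).
Proof.
have [a0 [a1 [a2 [a3 [a4 [a5 [a6 [a7 ->]]]]]]]] := oct8P a.
have [x0 [x1 [x2 [x3 [x4 [x5 [x6 [x7 ->]]]]]]]] := oct8P x.
have [y0 [y1 [y2 [y3 [y4 [y5 [y6 [y7 ->]]]]]]]] := oct8P y.
rewrite !oct8M; congr oct8; ring.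
Qed.

Lemma octonion_flexible a x : cdmul (cdmul a x) a = cdmul a (cdmul x a).
Proof.
by have := moufang_middle a x (cd1 R 3); rewrite cdmul1l cdmul1r.
Qed.

(** The image of the left Moufang identity under the anti-automorphism ⋄, once flexibility has
    regrouped a x a. *)
Lemma moufang_right a x y :
  cdmul y (cdmul a (cdmul x a)) = cdmul (cdmul (cdmul y a) x) a.
Proof.
apply: (can_inj (@cddiamK R 3)); rewrite !cddiamM octonion_flexible.
exact: moufang_left.
Qed.

Lemma octonion_mulKr a x : cdmul (cdmul x (cddiam a)) a = cdnm a *: x.
Proof.
apply: (can_inj (@cddiamK R 3)).
by rewrite !cddiamM cddiamK octonion_mulKV cddiamZ.
Qed.

End Octonions.

End OctonionIdentities.

(** * Real unit octonions *)

Section RealOctonions.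
Variable R : realType.
Implicit Types (p q r : R) (a b y w : CD R 3).

Lemma conjc_real r : conjc (r%:C) = r%:C.
Proof. by rewrite /= oppr0. Qed.

Lemma unit_orthogonal p q : exists s t : R, s * s + t * t = 1 /\ s * p + t * q = 0.
Proof.
have sq_ge0 : 0 <= p ^+ 2 + q ^+ 2 by rewrite addr_ge0 ?sqr_ge0.
have [/eqP pq0|pq0] := boolP (p ^+ 2 + q ^+ 2 == 0).
  move/eqP: pq0; rewrite paddr_eq0 ?sqr_ge0 // !sqrf_eq0 => /andP[/eqP-> /eqP->].
  by exists 1, 0; split; rewrite !(mul0r, mulr0, mul1r, addr0).
set r := Num.sqrt (p ^+ 2 + q ^+ 2).
have r2 : r * r = p ^+ 2 + q ^+ 2 by rewrite -expr2 sqr_sqrtr.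
have r0 : r != 0 by rewrite sqrtr_eq0 -ltNge lt_neqAle eq_sym pq0.
exists (q / r), (- p / r); split; last by field.
transitivity ((p ^+ 2 + q ^+ 2) / (r * r)); first by field.
by rewrite r2 divff.
Qed.

(** Norm one makes multiplication by [a] an invertible isometry; reality makes it commute with
    entrywise conjugation, hence [spin a] with the involution of C_6. *)
Definition unit_real a := cdconj a = a /\ cdnm a = 1.

Lemma unit_real_diam a : unit_real a -> unit_real (cddiam a).
Proof. by move=> [ra na]; split; rewrite ?cdnm_diam // cdconj_diam ra. Qed.

Lemma unit_realM a b : unit_real a -> unit_real b -> unit_real (cdmul a b).
Proof.
move=> [ra na] [rb nb].
by split; rewrite ?octonion_nmM ?na ?nb ?mulr1 // cdconjM ra rb.
Qed.

Lemma unit_real_cd1 : unit_real (cd1 R 3).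
Proof. by split; [exact: cdconj1|rewrite /= !(mulr0, mulr1, addr0)]. Qed.

Lemma normalize_real y : cdconj y = y -> y <> 0 ->
  exists r : R, r != 0 /\ unit_real ((r^-1)%:C *: y).
Proof.
move=> ry /(cdnm_sqr ry)[r [r0 nr]]; exists r; split=> //.
split; first by rewrite cdconjZ ry conjc_real.
by rewrite cdnmZ nr -!rmorphM -invfM mulVf ?rmorph1 // mulf_neq0.
Qed.

(** The multiplier is the normalized conjugate of [y], since y^⋄ y is a scalar. *)
Lemma make_scalar_left y : cdconj y = y ->
  exists a, unit_real a /\ exists c, cdmul a y = c *: cd1 R 3.
Proof.
move=> ry; have [->|/eqP y0] := eqVneq y 0.
  exists (cd1 R 3); split; first exact: unit_real_cd1.
  by exists 0; rewrite cdmul0r scale0r.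
have [r [r0 ur]] := normalize_real ry y0.
exists (cddiam ((r^-1)%:C *: y)); split; first exact: unit_real_diam.
by exists ((r^-1)%:C * cdnm y); rewrite cddiamZ cdmulZl cdmul_diaml scalerA.
Qed.

Lemma make_scalar_right y : cdconj y = y ->
  exists a, unit_real a /\ exists c, cdmul y a = c *: cd1 R 3.
Proof.
move=> ry.
have [|a [ua [c hc]]] := @make_scalar_left (cddiam y).
  by rewrite cdconj_diam ry.
exists (cddiam a); split; first exact: unit_real_diam.
by exists c; rewrite -[y]cddiamK -cddiamM hc cddiamZ cddiam1.
Qed.

(** Such an [a] squares to -1, so a c a = -c for scalar c: the spin by [a] keeps a scalar (1,3)
    entry scalar. *)
Definition unit_imag a := unit_real a /\ cddiam a = - a.

Lemma unit_imag_sqr a : unit_imag a -> cdmul a a = - cd1 R 3.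
Proof.
move=> [[_ na] da]; have := cdmul_diamr a.
by rewrite da cdmulNr na scale1r => <-; rewrite opprK.
Qed.

Lemma real_octE y : cdconj y = y -> exists y0 y1 y2 y3 y4 y5 y6 y7 : R,
  y = oct8 y0%:C y1%:C y2%:C y3%:C y4%:C y5%:C y6%:C y7%:C.
Proof.
have realE (z : R[i]) : conjc z = z -> z = (complex.Re z)%:C.
  by case: z => u v [/eqP]; rewrite eq_sym -addr_eq0 -mulr2n mulrn_eq0 => /eqP ->.
have [x0 [x1 [x2 [x3 [x4 [x5 [x6 [x7 ->]]]]]]]] := oct8P y.
move=> -[/realE h0 /realE h1 /realE h2 /realE h3 /realE h4 /realE h5 /realE h6 /realE h7].
do 8!eexists; rewrite {1}h0 {1}h1 {1}h2 {1}h3 {1}h4 {1}h5 {1}h6 {1}h7; reflexivity.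
Qed.

Lemma oct8_real (y0 y1 y2 y3 y4 y5 y6 y7 : R) :
  cdconj (oct8 y0%:C y1%:C y2%:C y3%:C y4%:C y5%:C y6%:C y7%:C) =
  oct8 y0%:C y1%:C y2%:C y3%:C y4%:C y5%:C y6%:C y7%:C.
Proof. by rewrite /oct8 /= oppr0. Qed.

(* Any octonion is moved to a scalar by two left multiplications with
   imaginary units: the first makes it imaginary. *)
Lemma make_scalar_imag y : cdconj y = y ->
  exists a b, [/\ unit_imag a, unit_imag b
    & exists c, cdmul b (cdmul a y) = c *: cd1 R 3].
Proof.
move=> ry.
have [a [ua day]] : exists a, unit_imag a /\
    cddiam (cdmul a y) = - cdmul a y.
  have [y0 [y1 [y2 [y3 [y4 [y5 [y6 [y7 ->]]]]]]]] := real_octE ry.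
  have [s [t [st1 st0]]] := unit_orthogonal y1 y2.
  have {}st0 : s%:C * y1%:C + t%:C * y2%:C = 0 :> R[i].
    by rewrite -!rmorphM -rmorphD st0.
  have {}st1 : s%:C * s%:C + t%:C * t%:C = 1 :> R[i].
    by rewrite -!rmorphM -rmorphD st1.
  (* The scalar part of a y is -(s y1 + t y2), which vanishes by the choice of (s, t). *)
  exists (oct8 0%:C s%:C t%:C 0%:C 0%:C 0%:C 0%:C 0%:C); split.
    split; first split; first exact: oct8_real.
      by rewrite oct8_nm -st1; ring.
    by rewrite oct8_diam -scaleN1r oct8Z; congr oct8; ring.
  rewrite oct8M oct8_diam -scaleN1r oct8Z; congr oct8; try ring.
  have -> : s%:C * y1%:C = - (t%:C * y2%:C) :> R[i].
    by apply/eqP; rewrite -addr_eq0 st0.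
  ring.
have ra : cdconj (cdmul a y) = cdmul a y by rewrite cdconjM ry ua.1.1.
have [ay0|/eqP ay0] := eqVneq (cdmul a y) 0.
  by exists a, a; split=> //; exists 0; rewrite ay0 cdmul0r scale0r.
have [r [r0 ur]] := normalize_real ra ay0.
(* The second unit is a y itself, normalized: an imaginary octonion has a scalar square. *)
exists a, ((r^-1)%:C *: cdmul a y); split=> //.
  by split=> //; rewrite cddiamZ day scalerN.
exists (- ((r^-1)%:C * cdnm (cdmul a y))).
rewrite cdmulZl scaleNr -scalerA -cdmul_diamr.
by rewrite day cdmulNr scalerN opprK.
Qed.

End RealOctonions.

(** * Moving a real octonion into the quaternions *)

Section Biquaternion.
Variable R : realType.
Implicit Types (w : CD R 3).

(** Orthogonal imaginary octonions anticommute; the inner product here is m (q1 p1 + q2 p2). *)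
Lemma anticomm_imag (m p1 p2 p3 q1 q2 g0 g1 g2 g3 : R[i]) :
    q1 * p1 = - (q2 * p2) ->
  cdmul (oct8 0 (m * p1) (m * p2) (m * p3) g0 g1 g2 g3)
        (oct8 0 q1 q2 0 0 0 0 0) =
  - cdmul (oct8 0 q1 q2 0 0 0 0 0)
          (oct8 0 (m * p1) (m * p2) (m * p3) g0 g1 g2 g3).
Proof.
move=> pq; rewrite !oct8M -scaleN1r oct8Z.
congr oct8; ring: pq.
Qed.

Lemma snd_oct8 (x0 x1 x2 x3 x4 x5 x6 x7 : R[i]) :
  x4 = 0 -> x5 = 0 -> x6 = 0 -> x7 = 0 ->
  (oct8 x0 x1 x2 x3 x4 x5 x6 x7).2 = 0.
Proof. by move=> -> -> -> ->. Qed.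

(* With [v] the imaginary part of [w], [N = |v|], [n i'] its part in
   [H], the imaginary [a = v + N i'] bisects [v] and [i'], so that [a w a]
   is in [H]; and [(w a) (h a) = - (a w a) h] when [h] is orthogonal to the
   quaternion algebra spanned by [a] and [w]. *)
Lemma bisector_snd (s n N p1 p2 p3 q1 q2 g0 g1 g2 g3 : R[i])
    (a := oct8 0 ((n + N) * p1) ((n + N) * p2) ((n + N) * p3) g0 g1 g2 g3) :
    q1 * p1 = - (q2 * p2) ->
    p3 * p3 = 1 - p1 * p1 - p2 * p2 ->
    N * N = n * n + (g0 * g0 + g1 * g1 + g2 * g2 + g3 * g3) ->
  (cdmul (cdmul (oct8 s (n * p1) (n * p2) (n * p3) g0 g1 g2 g3) a)
         (cdmul (oct8 0 q1 q2 0 0 0 0 0) a)).2 = 0.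
Proof.
move=> pq pp nN; rewrite /a !oct8M.
apply: snd_oct8; ring: pq pp nN.
Qed.

(** Polar form of a vector of R^3, with an arbitrary direction for the zero vector. The unit
    condition is solved for p3 * p3 because [bisector_snd] hands it to [ring] as a rewriting
    rule. *)
Lemma unit_direction (u v t : R) : exists n p1 p2 p3 : R,
  [/\ p3 * p3 = 1 - p1 * p1 - p2 * p2, 0 <= n
    & [/\ u = n * p1, v = n * p2 & t = n * p3]].
Proof.
have sum_ge0 : 0 <= u ^+ 2 + v ^+ 2 by rewrite addr_ge0 ?sqr_ge0.
have sq_ge0 : 0 <= u ^+ 2 + v ^+ 2 + t ^+ 2 by rewrite addr_ge0 ?sqr_ge0.
have [/eqP uvt0|uvt0] := boolP (u ^+ 2 + v ^+ 2 + t ^+ 2 == 0).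
  move/eqP: uvt0; rewrite paddr_eq0 ?sqr_ge0 // => /andP[].
  rewrite paddr_eq0 ?sqr_ge0 // !sqrf_eq0 => /andP[/eqP-> /eqP->] /eqP->.
  by exists 0, 1, 0, 0; split=> //; [ring | split; ring].
set r := Num.sqrt (u ^+ 2 + v ^+ 2 + t ^+ 2).
have r2 : r * r = u ^+ 2 + v ^+ 2 + t ^+ 2 by rewrite -expr2 sqr_sqrtr.
have r0 : r != 0 by rewrite sqrtr_eq0 -ltNge lt_neqAle eq_sym uvt0.
exists r, (u / r), (v / r), (t / r); split; last 1 first.
- by split; field.
- have -> : 1 = (u ^+ 2 + v ^+ 2 + t ^+ 2) / (r * r) by rewrite -r2 divff // mulf_neq0.
  by field.
exact: sqrtr_ge0.
Qed.

Lemma cdmul_snd0 n (x y : CD R n.+1) : x.2 = 0 -> y.2 = 0 -> (cdmul x y).2 = 0.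
Proof. by move=> /= -> ->; rewrite !cdmul0r addr0. Qed.

Lemma cdscale_snd0 n c (x : CD R n.+1) : x.2 = 0 -> (c *: x).2 = 0.
Proof. by move=> /= ->; rewrite scaler0. Qed.

Lemma imag_scaled_unit (a : CD R 3) : cdconj a = a -> a <> 0 ->
  cddiam a = - a -> exists r : R, unit_imag (r%:C *: a).
Proof.
move=> ra a0 da; have [r [r0 ur]] := normalize_real ra a0.
by exists r^-1; split=> //; rewrite cddiamZ da scalerN.
Qed.

Lemma unit_imag_mulK (a x : CD R 3) : unit_imag a -> cdmul (cdmul x a) a = - x.
Proof.
move=> [[_ na] da]; have := octonion_mulKr a x.
by rewrite da cdmulNr cdmulNl na scale1r => /(congr1 -%R); rewrite opprK.
Qed.

(** Spins by [a], then [b], send a scalar p at (1,2) to p (b a) and the entry w at (2,3) to (w a) b,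
    so one pair must bring both into H. That both are imaginary keeps the (1,3) entry scalar. *)
Lemma make_biquaternion w : cdconj w = w ->
  exists a b, [/\ unit_imag a, unit_imag b, (cdmul b a).2 = 0
    & (cdmul (cdmul w a) b).2 = 0].
Proof.
move=> rw; have [w20|/eqP w20] := eqVneq w.2 0.
  pose i := oct8 0%:C 1%:C 0%:C 0%:C 0%:C 0%:C 0%:C 0%:C : CD R 3.
  have ui : unit_imag i.
    split; first split; first exact: oct8_real.
      by rewrite /i oct8_nm; ring.
    by rewrite oct8_diam -scaleN1r oct8Z; congr oct8; ring.
  have i2 : i.2 = 0 by exact: snd_oct8.
  exists i, i; split=> //; first exact: (@cdmul_snd0 2 i i).
  exact: (@cdmul_snd0 2 _ i (@cdmul_snd0 2 w i w20 i2)).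
have [s [x1 [x2 [x3 [g0 [g1 [g2 [g3 def_w]]]]]]]] := real_octE rw.
have [n [p1 [p2 [p3 [pp n0 [e1 e2 e3]]]]]] := unit_direction x1 x2 x3.
have [q1 [q2 [qq pq]]] := unit_orthogonal p1 p2.
pose G := g0 * g0 + g1 * g1 + g2 * g2 + g3 * g3.
have G0 : 0 <= n * n + G by rewrite /G -!expr2 !addr_ge0 ?sqr_ge0.
pose N := Num.sqrt (n * n + G).
have nN : N * N = n * n + G by rewrite -expr2 sqr_sqrtr.
have {}pq : q1 * p1 = - (q2 * p2) by apply/eqP; rewrite -addr_eq0 pq.
(* An imaginary quaternion unit orthogonal to the direction (p1, p2, p3), hence to both imaginary
   vectors v and a. *)
pose h := oct8 0%:C q1%:C q2%:C 0%:C 0%:C 0%:C 0%:C 0%:C : CD R 3.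
have uh : unit_imag h.
  split; first split; first exact: oct8_real.
    rewrite /h oct8_nm -(rmorph1 (real_complex R)) -qq rmorphD !rmorphM /=; ring.
  by rewrite oct8_diam -scaleN1r oct8Z; congr oct8; ring.
(* The bisector v + N i' before normalization. Its component outside H is that of w, hence
   nonzero. *)
pose a0 := oct8 0%:C ((n + N) * p1)%:C ((n + N) * p2)%:C ((n + N) * p3)%:C
  g0%:C g1%:C g2%:C g3%:C : CD R 3.
have a0nz : a0 <> 0.
  move=> a00; apply: w20; rewrite def_w.
  by move: (congr1 snd a00).
have [|r ua] := imag_scaled_unit (oct8_real _ _ _ _ _ _ _ _) a0nz.
  by rewrite oct8_diam -scaleN1r oct8Z; congr oct8; ring.
have ah : cdmul a0 h = - cdmul h a0.
  rewrite /a0 /h !(rmorphM (real_complex R)) !(rmorph0 (real_complex R)).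
  apply: anticomm_imag.
  by rewrite -!rmorphM pq rmorphN.
have w_eq : w = oct8 s%:C (n%:C * p1%:C) (n%:C * p2%:C) (n%:C * p3%:C)
  g0%:C g1%:C g2%:C g3%:C by rewrite -!rmorphM -e1 -e2 -e3.
(* With b = h a, one has b a = (h a) a = -h, which lies in H; b is imaginary because a and h
   anticommute. *)
exists (r%:C *: a0), (cdmul h (r%:C *: a0)); split=> //.
- split; first exact: unit_realM uh.1 ua.1.
  by rewrite cddiamM ua.2 uh.2 cdmulNl cdmulNr opprK cdmulZl cdmulZr ah scalerN.
- by rewrite unit_imag_mulK // -[LHS]/(- h.2) snd_oct8 ?rmorph0 ?oppr0.
rewrite !(cdmulZl, cdmulZr); do 2!apply: (@cdscale_snd0 2).
rewrite w_eq /a0 /h !(rmorphM (real_complex R)) !(rmorphD (real_complex R))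
  !(rmorph0 (real_complex R)).
apply: bisector_snd.
- by rewrite -!rmorphM pq rmorphN.
- by rewrite -!rmorphM pp !rmorphB rmorph1.
- by rewrite -!rmorphM nN /G !rmorphD.
Qed.

End Biquaternion.

(** * Automorphisms of C_6 *)

Section Entries.
Variable R : realType.
Implicit Types (c : R[i]) (x y : C6 R).

Definition i0 : 'I_3 := @Ordinal 3 0 isT.
Definition i1 : 'I_3 := @Ordinal 3 1 isT.
Definition i2 : 'I_3 := @Ordinal 3 2 isT.

Lemma ord3P (P : 'I_3 -> Prop) : P i0 -> P i1 -> P i2 -> forall i, P i.
Proof.
move=> P0 P1 P2 [[|[|[|//]]] lti].
- by rewrite (_ : Ordinal lti = i0) //; apply: val_inj.
- by rewrite (_ : Ordinal lti = i1) //; apply: val_inj.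
- by rewrite (_ : Ordinal lti = i2) //; apply: val_inj.
Qed.

Lemma sum3E (V : nmodType) (F : 'I_3 -> V) : \sum_i F i = F i0 + F i1 + F i2.
Proof.
rewrite !big_ord_recl big_ord0 addr0 addrA.
by congr (F _ + F _ + F _); apply: val_inj.
Qed.

Lemma c6_upperP x y :
  c6mx x i0 i0 = c6mx y i0 i0 -> c6mx x i1 i1 = c6mx y i1 i1 ->
  c6mx x i2 i2 = c6mx y i2 i2 -> c6mx x i0 i1 = c6mx y i0 i1 ->
  c6mx x i1 i2 = c6mx y i1 i2 -> c6mx x i0 i2 = c6mx y i0 i2 -> x = y.
Proof.
move=> e00 e11 e22 e01 e12 e02; apply: c6P.
elim/ord3P; elim/ord3P => //; rewrite -cddiam_c6 -[in RHS]cddiam_c6.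
- by rewrite e01.
- by rewrite e02.
by rewrite e12.
Qed.

Lemma c6linE c x y i j :
  c6mx (c *: x + y) i j = c *: c6mx x i j + c6mx y i j.
Proof. by rewrite c6D omxD c6scaleE. Qed.

Lemma c6starE x i j : c6mx (c6star x) i j = cdconj (c6mx x i j).
Proof. by rewrite /c6star /= ostarE cdstarE cddiam_c6. Qed.

Lemma c6jordan3E x y i j : c6mx (c6jordan x y) i j =
  2^-1 *: (cdmul (c6mx x i i0) (c6mx y i0 j) + cdmul (c6mx x i i1) (c6mx y i1 j)
    + cdmul (c6mx x i i2) (c6mx y i2 j)
    + (cdmul (c6mx y i i0) (c6mx x i0 j) + cdmul (c6mx y i i1) (c6mx x i1 j)
    + cdmul (c6mx y i i2) (c6mx x i2 j))).
Proof. by rewrite /c6jordan /= ojordanE !sum3E. Qed.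

Lemma c6_diagE x i : exists c, c6mx x i i = c *: cd1 R 3.
Proof. by apply: cddiam_fixed; rewrite cddiam_c6. Qed.

End Entries.

Section Automorphisms.
Variable R : realType.
Implicit Types (x y : C6 R) (T U : C6 R -> C6 R).

Lemma jaut_id : jordan_star_automorphism (@id (C6 R)).
Proof. by split=> //; exists id. Qed.

Lemma jaut_comp T U : jordan_star_automorphism T ->
  jordan_star_automorphism U -> jordan_star_automorphism (T \o U).
Proof.
move=> [lT bT jT sT] [lU bU jU sU]; split=> /=.
- by move=> c x y /=; rewrite lU lT.
- exact: bij_comp.
- by move=> x y /=; rewrite jU jT.
by move=> x /=; rewrite sU sT.
Qed.

Lemma jaut_inv T : jordan_star_automorphism T -> exists U,
  [/\ jordan_star_automorphism U, cancel T U & cancel U T].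
Proof.
move=> [lT bT jT sT]; have [U TK UK] := bT; exists U; split=> //; split.
- by move=> c x y; apply: (can_inj TK); rewrite lT !UK.
- by exists T.
- by move=> x y; apply: (can_inj TK); rewrite jT !UK.
by move=> x; apply: (can_inj TK); rewrite sT !UK.
Qed.

Lemma jautD T x y : jordan_star_automorphism T -> T (x + y) = T x + T y.
Proof. by case=> lT _ _ _; have := lT 1 x y; rewrite !scale1r. Qed.

Lemma jautZ T c x : jordan_star_automorphism T -> T (c *: x) = c *: T x.
Proof.
move=> aT; have T0 : T 0 = 0.
  by apply: (addIr (T 0)); rewrite -jautD // addr0 add0r.
by case: aT => lT _ _ _; have := lT c x 0; rewrite T0 !addr0.
Qed.

End Automorphisms.

(** * Automorphisms of spin type *)

Section SpinAutomorphisms.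
Local Arguments cdmul : simpl never.
Local Arguments cddiam : simpl never.
Variable R : realType.
Implicit Types (c : R[i]) (x y : C6 R) (a u v : octonion R).

Lemma addr_pairs (V : nmodType) (p q r s t w : V) :
  p + q + r + (s + t + w) = p + s + (q + t) + (r + w).
Proof. by rewrite addrACA [p + q + _]addrACA. Qed.

(** This and the next five formulas express the product through the diagonal and the entries (1,2),
    (2,3), (1,3) only, in symmetrised pairs to which polarization or a Moufang identity applies. *)
Lemma jordan00E x y : c6mx (c6jordan x y) i0 i0 = 2^-1 *:
  (cdmul (c6mx x i0 i0) (c6mx y i0 i0) + cdmul (c6mx y i0 i0) (c6mx x i0 i0) +
   (cdmul (c6mx x i0 i1) (cddiam (c6mx y i0 i1)) +
    cdmul (c6mx y i0 i1) (cddiam (c6mx x i0 i1))) +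
   (cdmul (c6mx x i0 i2) (cddiam (c6mx y i0 i2)) +
    cdmul (c6mx y i0 i2) (cddiam (c6mx x i0 i2)))).
Proof. by rewrite c6jordan3E addr_pairs !cddiam_c6. Qed.

Lemma jordan11E x y : c6mx (c6jordan x y) i1 i1 = 2^-1 *:
  (cdmul (cddiam (c6mx x i0 i1)) (c6mx y i0 i1) +
    cdmul (cddiam (c6mx y i0 i1)) (c6mx x i0 i1) +
   (cdmul (c6mx x i1 i1) (c6mx y i1 i1) +
    cdmul (c6mx y i1 i1) (c6mx x i1 i1)) +
   (cdmul (c6mx x i1 i2) (cddiam (c6mx y i1 i2)) +
    cdmul (c6mx y i1 i2) (cddiam (c6mx x i1 i2)))).
Proof. by rewrite c6jordan3E addr_pairs !cddiam_c6. Qed.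

Lemma jordan22E x y : c6mx (c6jordan x y) i2 i2 = 2^-1 *:
  (cdmul (cddiam (c6mx x i0 i2)) (c6mx y i0 i2) +
    cdmul (cddiam (c6mx y i0 i2)) (c6mx x i0 i2) +
   (cdmul (cddiam (c6mx x i1 i2)) (c6mx y i1 i2) +
    cdmul (cddiam (c6mx y i1 i2)) (c6mx x i1 i2)) +
   (cdmul (c6mx x i2 i2) (c6mx y i2 i2) +
    cdmul (c6mx y i2 i2) (c6mx x i2 i2))).
Proof. by rewrite c6jordan3E addr_pairs !cddiam_c6. Qed.

Lemma jordan01E x y : c6mx (c6jordan x y) i0 i1 = 2^-1 *:
  (cdmul (c6mx x i0 i0) (c6mx y i0 i1) + cdmul (c6mx y i0 i0) (c6mx x i0 i1) +
   (cdmul (c6mx x i0 i1) (c6mx y i1 i1) +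
    cdmul (c6mx y i0 i1) (c6mx x i1 i1)) +
   (cdmul (c6mx x i0 i2) (cddiam (c6mx y i1 i2)) +
    cdmul (c6mx y i0 i2) (cddiam (c6mx x i1 i2)))).
Proof. by rewrite c6jordan3E addr_pairs !cddiam_c6. Qed.

Lemma jordan12E x y : c6mx (c6jordan x y) i1 i2 = 2^-1 *:
  (cdmul (cddiam (c6mx x i0 i1)) (c6mx y i0 i2) +
    cdmul (cddiam (c6mx y i0 i1)) (c6mx x i0 i2) +
   (cdmul (c6mx x i1 i1) (c6mx y i1 i2) +
    cdmul (c6mx y i1 i1) (c6mx x i1 i2)) +
   (cdmul (c6mx x i1 i2) (c6mx y i2 i2) +
    cdmul (c6mx y i1 i2) (c6mx x i2 i2))).
Proof. by rewrite c6jordan3E addr_pairs !cddiam_c6. Qed.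

Lemma jordan02E x y : c6mx (c6jordan x y) i0 i2 = 2^-1 *:
  (cdmul (c6mx x i0 i0) (c6mx y i0 i2) + cdmul (c6mx y i0 i0) (c6mx x i0 i2) +
   (cdmul (c6mx x i0 i1) (c6mx y i1 i2) +
    cdmul (c6mx y i0 i1) (c6mx x i1 i2)) +
   (cdmul (c6mx x i0 i2) (c6mx y i2 i2) +
    cdmul (c6mx y i0 i2) (c6mx x i2 i2))).
Proof. by rewrite c6jordan3E addr_pairs. Qed.

Lemma cdmul_scalarl n c (z : CD R n) : cdmul (c *: cd1 R n) z = c *: z.
Proof. by rewrite cdmulZl cdmul1l. Qed.

Lemma cdmul_scalarr n c (z : CD R n) : cdmul z (c *: cd1 R n) = c *: z.
Proof. by rewrite cdmulZr cdmul1r. Qed.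

Section Scalars.
Variables (n : nat) (a : CD R n).

Lemma scalar_mullA s z : (exists c, s = c *: cd1 R n) ->
  cdmul a (cdmul s z) = cdmul s (cdmul a z).
Proof. by case=> c ->; rewrite !cdmul_scalarl cdmulZr. Qed.

Lemma scalar_mulrA s z : (exists c, s = c *: cd1 R n) ->
  cdmul a (cdmul z s) = cdmul (cdmul a z) s.
Proof. by case=> c ->; rewrite !cdmul_scalarr cdmulZr. Qed.

Lemma scalar_mullAr s z : (exists c, s = c *: cd1 R n) ->
  cdmul (cdmul s z) a = cdmul s (cdmul z a).
Proof. by case=> c ->; rewrite !cdmul_scalarl cdmulZl. Qed.

Lemma scalar_mulrAr s z : (exists c, s = c *: cd1 R n) ->
  cdmul (cdmul z s) a = cdmul (cdmul z a) s.
Proof. by case=> c ->; rewrite !cdmul_scalarr cdmulZl. Qed.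

Lemma scalar_mullAb s z : (exists c, s = c *: cd1 R n) ->
  cdmul a (cdmul (cdmul s z) a) = cdmul s (cdmul a (cdmul z a)).
Proof. by move=> hs; rewrite scalar_mullAr // scalar_mullA. Qed.

Lemma scalar_mulrAb s z : (exists c, s = c *: cd1 R n) ->
  cdmul a (cdmul (cdmul z s) a) = cdmul (cdmul a (cdmul z a)) s.
Proof. by move=> hs; rewrite scalar_mulrAr // scalar_mulrA. Qed.

End Scalars.

(** Shaped after the right-hand sides of [jordan01E], [jordan12E] and [jordan02E], to compare them
    term by term. *)
Lemma half_sum_morph (V W : lmodType R[i]) (f : V -> W)
    (p1 p2 p3 p4 p5 p6 : V) (q1 q2 q3 q4 q5 q6 : W) :
  {morph f : u v / u + v} -> (forall c (z : V), f (c *: z) = c *: f z) ->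
  f p1 = q1 -> f p2 = q2 -> f p3 = q3 -> f p4 = q4 -> f p5 = q5 -> f p6 = q6 ->
  f (2^-1 *: (p1 + p2 + (p3 + p4) + (p5 + p6))) =
  2^-1 *: (q1 + q2 + (q3 + q4) + (q5 + q6)).
Proof. by move=> fD fZ <- <- <- <- <- <-; rewrite fZ !fD. Qed.

Section Isometry.
Variable f : octonion R -> octonion R.
Hypotheses (fD : {morph f : u v / u + v}) (fN : forall u, cdnm (f u) = cdnm u).

(** Both sides are the polar form of [cdnm]. It is applied to left, right and two-sided
    multiplication by a unit, which handles the diagonal entries. *)
Lemma isometry_polarl u v :
  cdmul (f u) (cddiam (f v)) + cdmul (f v) (cddiam (f u)) =
  cdmul u (cddiam v) + cdmul v (cddiam u).
Proof. by rewrite !cdmul_diam_polar -fD !fN. Qed.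

Lemma isometry_polarr u v :
  cdmul (cddiam (f u)) (f v) + cdmul (cddiam (f v)) (f u) =
  cdmul (cddiam u) v + cdmul (cddiam v) u.
Proof.
have polar p q : cdmul (cddiam p) q + cdmul (cddiam q) p =
    (cdnm (p + q) - cdnm p - cdnm q) *: cd1 R 3.
  rewrite -{1}[q]cddiamK -{2}[p]cddiamK cdmul_diam_polar.
  by rewrite -cddiamD !cdnm_diam.
by rewrite !polar -fD !fN.
Qed.

End Isometry.

(** Formally the conjugation x |-> D x D^⋄ with D = diag(a, 1, a^⋄), with a bracketing fixed for
    each entry. The entries below the diagonal are forced by x^⋄ = x. *)
Definition spin_mx a (x : 'M[octonion R]_3) : 'M[octonion R]_3 :=
  \matrix_(i, j) match val i, val j with
  | 0, 1 => cdmul a (x i j)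
  | 1, 0 => cdmul (x i j) (cddiam a)
  | 1, 2 => cdmul (x i j) a
  | 2, 1 => cdmul (cddiam a) (x i j)
  | 0, 2 => cdmul a (cdmul (x i j) a)
  | 2, 0 => cdmul (cdmul (cddiam a) (x i j)) (cddiam a)
  | _, _ => x i j
  end.

Lemma spin_mxE a (x : 'M[octonion R]_3) i j : spin_mx a x i j =
  match val i, val j with
  | 0, 1 => cdmul a (x i j)
  | 1, 0 => cdmul (x i j) (cddiam a)
  | 1, 2 => cdmul (x i j) a
  | 2, 1 => cdmul (cddiam a) (x i j)
  | 0, 2 => cdmul a (cdmul (x i j) a)
  | 2, 0 => cdmul (cdmul (cddiam a) (x i j)) (cddiam a)
  | _, _ => x i j
  end.
Proof. exact: mxE. Qed.

Lemma spin_subproof a x : odiam (spin_mx a x) == spin_mx a x.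
Proof.
apply/eqP/matrixP; elim/ord3P; elim/ord3P; rewrite odiamE !spin_mxE /=;
  by rewrite ?cddiamM ?cddiamK ?cddiam_c6.
Qed.

End SpinAutomorphisms.

HB.lock Definition spin (R : realType) (a : octonion R) (x : C6 R) : C6 R :=
  MkC6 (spin_subproof a x).

Section SpinTheory.
Variable R : realType.
Local Arguments cdmul : simpl never.
Local Arguments cddiam : simpl never.
Implicit Types (c : R[i]) (x y : C6 R) (a u v : octonion R).

Lemma c6mx_spin a x : c6mx (spin a x) = spin_mx a x.
Proof. by rewrite spin.unlock. Qed.

Lemma spin_diagE a x i : c6mx (spin a x) i i = c6mx x i i.
Proof. by rewrite c6mx_spin; elim/ord3P: i; apply: mxE. Qed.

Lemma spin01E a x : c6mx (spin a x) i0 i1 = cdmul a (c6mx x i0 i1).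
Proof. by rewrite c6mx_spin; apply: mxE. Qed.

Lemma spin12E a x : c6mx (spin a x) i1 i2 = cdmul (c6mx x i1 i2) a.
Proof. by rewrite c6mx_spin; apply: mxE. Qed.

Lemma spin02E a x : c6mx (spin a x) i0 i2 = cdmul a (cdmul (c6mx x i0 i2) a).
Proof. by rewrite c6mx_spin; apply: mxE. Qed.

Definition spinE := (spin_diagE, spin01E, spin12E, spin02E).

Lemma unit_mulKV a u : unit_real a -> cdmul (cddiam a) (cdmul a u) = u.
Proof. by move=> [_ na]; rewrite octonion_mulKV na scale1r. Qed.

Lemma unit_mulK a u : unit_real a -> cdmul a (cdmul (cddiam a) u) = u.
Proof. by move=> [_ na]; rewrite octonion_mulK na scale1r. Qed.

Lemma unit_mulKr a u : unit_real a -> cdmul (cdmul u (cddiam a)) a = u.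
Proof. by move=> [_ na]; rewrite octonion_mulKr na scale1r. Qed.

Lemma unit_mulKVr a u : unit_real a -> cdmul (cdmul u a) (cddiam a) = u.
Proof.
by move=> /unit_real_diam/(unit_mulKr u); rewrite cddiamK.
Qed.

Lemma spinK a : unit_real a -> cancel (spin a) (spin (cddiam a)).
Proof.
move=> ua x; apply: c6_upperP; rewrite !spinE //.
- exact: unit_mulKV.
- exact: unit_mulKVr.
by rewrite -(octonion_flexible a) unit_mulKVr // unit_mulKV.
Qed.

(** The left Moufang identity with last factor a^⋄ v^⋄, where the inner a cancels. It matches the
    actions on (1,2), (1,3) and (2,3). *)
Lemma spin_mulA a u v : unit_real a ->
  cdmul a (cdmul u (cddiam v)) =
  cdmul (cdmul a (cdmul u a)) (cddiam (cdmul v a)).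
Proof. by move=> ua; rewrite cddiamM moufang_left unit_mulK. Qed.

Lemma spin_mulAr a u v : unit_real a ->
  cdmul (cdmul (cddiam u) v) a =
  cdmul (cddiam (cdmul a u)) (cdmul a (cdmul v a)).
Proof. by move=> ua; rewrite cddiamM moufang_right unit_mulKr. Qed.

(** Diagonal entries are preserved because the three multiplications are isometries. Off the
    diagonal, terms with a diagonal factor are handled by centrality of scalars, and the cross terms
    by the left, right and middle Moufang identities at (1,2), (2,3) and (1,3). *)
Lemma spin_jordan a : unit_real a -> {morph spin a : x y / c6jordan x y}.
Proof.
move=> ua x y; have na : cdnm a = 1 by case: ua.
have nl u : cdnm (cdmul a u) = cdnm u by rewrite octonion_nmM na mul1r.
have nr u : cdnm (cdmul u a) = cdnm u by rewrite octonion_nmM na mulr1.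
have nb u : cdnm (cdmul a (cdmul u a)) = cdnm u by rewrite nl nr.
have Dr : {morph (fun u => cdmul u a) : u v / u + v} by move=> u v; apply: cdmulDl.
have Db : {morph (fun u => cdmul a (cdmul u a)) : u v / u + v}.
  by move=> u v /=; rewrite cdmulDl cdmulDr.
have Zb c z : cdmul a (cdmul (c *: z) a) = c *: cdmul a (cdmul z a).
  by rewrite cdmulZl cdmulZr.
apply: c6_upperP.
- apply: etrans (spin_diagE _ _ _) _.
  apply: etrans (jordan00E _ _) _.
  apply: etrans _ (esym (jordan00E _ _)).
  rewrite !spin_diagE !spin01E !spin02E.
  by rewrite (isometry_polarl (cdmulDr a) nl) (isometry_polarl Db nb).
- apply: etrans (spin_diagE _ _ _) _.
  apply: etrans (jordan11E _ _) _.
  apply: etrans _ (esym (jordan11E _ _)).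
  rewrite !spin_diagE !spin01E !spin12E.
  by rewrite (isometry_polarr (cdmulDr a) nl) (isometry_polarl Dr nr).
- apply: etrans (spin_diagE _ _ _) _.
  apply: etrans (jordan22E _ _) _.
  apply: etrans _ (esym (jordan22E _ _)).
  rewrite !spin_diagE !spin02E !spin12E.
  by rewrite (isometry_polarr Db nb) (isometry_polarr Dr nr).
- apply: etrans (spin01E _ _) _.
  apply: etrans (congr1 (cdmul a) (jordan01E _ _)) _.
  apply: etrans _ (esym (jordan01E _ _)).
  rewrite !spin_diagE !spin01E !spin02E !spin12E.
  apply: (half_sum_morph (cdmulDr a) (fun c => @cdmulZr R 3 c a)).
  + exact: scalar_mullA (c6_diagE x i0).
  + exact: scalar_mullA (c6_diagE y i0).
  + exact: scalar_mulrA (c6_diagE y i1).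
  + exact: scalar_mulrA (c6_diagE x i1).
  + exact: spin_mulA.
  exact: spin_mulA.
- apply: etrans (spin12E _ _) _.
  apply: etrans (congr1 (fun z => cdmul z a) (jordan12E _ _)) _.
  apply: etrans _ (esym (jordan12E _ _)).
  rewrite !spin_diagE !spin12E !spin01E !spin02E.
  apply: (half_sum_morph (cdmulDl a) (fun c z => @cdmulZl R 3 c z a)).
  + exact: spin_mulAr.
  + exact: spin_mulAr.
  + exact: scalar_mullAr (c6_diagE x i1).
  + exact: scalar_mullAr (c6_diagE y i1).
  + exact: scalar_mulrAr (c6_diagE y i2).
  exact: scalar_mulrAr (c6_diagE x i2).
apply: etrans (spin02E _ _) _.
apply: etrans (congr1 (fun z => cdmul a (cdmul z a)) (jordan02E _ _)) _.
apply: etrans _ (esym (jordan02E _ _)).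
rewrite !spin_diagE !spin02E !spin01E !spin12E.
apply: (half_sum_morph Db Zb).
+ exact: scalar_mullAb (c6_diagE x i0).
+ exact: scalar_mullAb (c6_diagE y i0).
+ exact: esym (moufang_middle _ _ _).
+ exact: esym (moufang_middle _ _ _).
+ exact: scalar_mulrAb (c6_diagE y i2).
exact: scalar_mulrAb (c6_diagE x i2).
Qed.

Lemma spin_jaut a : unit_real a -> jordan_star_automorphism (spin a).
Proof.
move=> ua; have ra : cdconj a = a by case: ua.
split.
- move=> c x y; apply: c6_upperP; rewrite !(spinE, c6linE) //.
  + by rewrite cdmulDr cdmulZr.
  + by rewrite cdmulDl cdmulZl.
  by rewrite cdmulDl cdmulZl cdmulDr cdmulZr.
- exists (spin (cddiam a)); first exact: spinK.
  by rewrite -{2}[a]cddiamK; apply/spinK/unit_real_diam.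
- exact: spin_jordan.
by move=> x; apply: c6_upperP; rewrite !(spinE, c6starE) // !cdconjM ra.
Qed.

End SpinTheory.

(* Sealed: unification would otherwise compare distinct actions by unfolding
   them down to coordinates. *)
HB.lock Definition rowact (R : realType) (Q : 'M[R]_3) (A : 'M[octonion R]_3)
    : 'M[octonion R]_3 :=
  \matrix_(i, j) \sum_k (Q i k)%:C *: A k j.

HB.lock Definition colact (R : realType) (Q : 'M[R]_3) (A : 'M[octonion R]_3)
    : 'M[octonion R]_3 :=
  \matrix_(i, j) \sum_l (Q j l)%:C *: A i l.

(** * Conjugation by real orthogonal matrices *)

Section OrthogonalActions.
Variable R : realType.
Local Arguments cdmul : simpl never.
Local Arguments cddiam : simpl never.
Implicit Types (x y : C6 R) (A B : 'M[octonion R]_3) (Q : 'M[R]_3).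

Lemma rowactE Q A i j : rowact Q A i j = \sum_k (Q i k)%:C *: A k j.
Proof. by rewrite rowact.unlock; apply: mxE. Qed.

Lemma colactE Q A i j : colact Q A i j = \sum_l (Q j l)%:C *: A i l.
Proof. by rewrite colact.unlock; apply: mxE. Qed.

Lemma rowcolactC Q Q' A : rowact Q (colact Q' A) = colact Q' (rowact Q A).
Proof.
apply/matrixP => i j; rewrite rowactE colactE.
under eq_bigr do rewrite colactE scaler_sumr.
rewrite exchange_big /=; apply: eq_bigr => l _.
rewrite rowactE scaler_sumr; apply: eq_bigr => k _.
by rewrite !scalerA mulrC.
Qed.

Lemma rowactM Q Q' A : rowact Q (rowact Q' A) = rowact (Q *m Q') A.
Proof.
apply/matrixP => i j; rewrite !rowactE.
under eq_bigr do rewrite rowactE scaler_sumr.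
rewrite exchange_big /=; apply: eq_bigr => k _.
rewrite mxE rmorph_sum scaler_suml; apply: eq_bigr => l _.
by rewrite scalerA rmorphM.
Qed.

Lemma colactM Q Q' A : colact Q (colact Q' A) = colact (Q *m Q') A.
Proof.
apply/matrixP => i j; rewrite !colactE.
under eq_bigr do rewrite colactE scaler_sumr.
rewrite exchange_big /=; apply: eq_bigr => k _.
rewrite mxE rmorph_sum scaler_suml; apply: eq_bigr => l _.
by rewrite scalerA rmorphM.
Qed.

Lemma rowact1 A : rowact 1%:M A = A.
Proof.
apply/matrixP => i j; rewrite rowactE (bigD1 i) //= big1 ?addr0 => [|k neq].
  by rewrite mxE eqxx rmorph1 scale1r.
by rewrite mxE eq_sym (negPf neq) rmorph0 scale0r.
Qed.

Lemma colact1 A : colact 1%:M A = A.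
Proof.
apply/matrixP => i j; rewrite colactE (bigD1 j) //= big1 ?addr0 => [|k neq].
  by rewrite mxE eqxx rmorph1 scale1r.
by rewrite mxE eq_sym (negPf neq) rmorph0 scale0r.
Qed.

Lemma rowactD Q A B : rowact Q (A + B) = rowact Q A + rowact Q B.
Proof.
apply/matrixP => i j; rewrite omxD !rowactE -big_split; apply: eq_bigr => k _.
by rewrite omxD scalerDr.
Qed.

Lemma colactD Q A B : colact Q (A + B) = colact Q A + colact Q B.
Proof.
apply/matrixP => i j; rewrite omxD !colactE -big_split; apply: eq_bigr => k _.
by rewrite omxD scalerDr.
Qed.

Lemma rowactZ Q c A : rowact Q (oscalemx c A) = oscalemx c (rowact Q A).
Proof.
apply/matrixP => i j; rewrite oscalemxE !rowactE scaler_sumr.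
by apply: eq_bigr => k _; rewrite oscalemxE !scalerA mulrC.
Qed.

Lemma colactZ Q c A : colact Q (oscalemx c A) = oscalemx c (colact Q A).
Proof.
apply/matrixP => i j; rewrite oscalemxE !colactE scaler_sumr.
by apply: eq_bigr => k _; rewrite oscalemxE !scalerA mulrC.
Qed.

(** Real coefficients are scalars, so by bilinearity a real matrix moves through the nonassociative
    octonion product; this and the next two lemmas give the rules for the left, right and middle
    positions. *)
Lemma omulmx_rowact Q A B : omulmx (rowact Q A) B = rowact Q (omulmx A B).
Proof.
apply/matrixP => i j; rewrite omulmxE rowactE.
under eq_bigr do rewrite rowactE cdmul_suml.
rewrite exchange_big /=; apply: eq_bigr => k _.
rewrite omulmxE scaler_sumr; apply: eq_bigr => l _.
by rewrite cdmulZl.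
Qed.

Lemma omulmx_colact Q A B : omulmx A (colact Q B) = colact Q (omulmx A B).
Proof.
apply/matrixP => i j; rewrite omulmxE colactE.
under eq_bigr do rewrite colactE cdmul_sumr.
rewrite exchange_big /=; apply: eq_bigr => k _.
rewrite omulmxE scaler_sumr; apply: eq_bigr => l _.
by rewrite cdmulZr.
Qed.

Lemma omulmx_colrow Q A B :
  omulmx (colact Q A) B = omulmx A (rowact Q^T B).
Proof.
apply/matrixP => i j; rewrite !omulmxE.
under eq_bigr do rewrite colactE cdmul_suml.
rewrite exchange_big /=; apply: eq_bigr => k _.
rewrite rowactE cdmul_sumr; apply: eq_bigr => l _.
by rewrite cdmulZl cdmulZr mxE.
Qed.

Lemma conjQ_subproof Q x :
  odiam (rowact Q (colact Q x)) == rowact Q (colact Q x).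
Proof.
apply/eqP/matrixP => i j; rewrite [in RHS]rowcolactC odiamE rowactE colactE.
rewrite cddiam_sum; apply: eq_bigr => k _.
rewrite cddiamZ colactE rowactE cddiam_sum; congr (_ *: _).
by apply: eq_bigr => l _; rewrite cddiamZ cddiam_c6.
Qed.

End OrthogonalActions.

(** As [colact Q] is right multiplication by [Q^T], this is x |-> Q x Q^T. *)
HB.lock Definition conjQ (R : realType) (Q : 'M[R]_3) (x : C6 R) : C6 R :=
  MkC6 (conjQ_subproof Q x).

Section OrthogonalAutomorphisms.
Variable R : realType.
Implicit Types (x y : C6 R) (A B : 'M[octonion R]_3) (Q : 'M[R]_3).

Lemma c6mx_conjQ Q x : c6mx (conjQ Q x) = rowact Q (colact Q x).
Proof. by rewrite conjQ.unlock. Qed.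

Lemma conjQE Q x i j : c6mx (conjQ Q x) i j =
  \sum_k \sum_l ((Q i k)%:C * (Q j l)%:C) *: c6mx x k l.
Proof.
rewrite c6mx_conjQ rowactE; apply: eq_bigr => k _.
rewrite colactE scaler_sumr; apply: eq_bigr => l _.
by rewrite scalerA.
Qed.

Lemma conjQK Q Q' : Q' *m Q = 1%:M -> cancel (conjQ Q) (conjQ Q').
Proof.
move=> QQ' x; apply/val_inj; rewrite /= !c6mx_conjQ.
by rewrite -rowcolactC rowactM QQ' rowact1 colactM QQ' colact1.
Qed.

Lemma conjQ_jaut Q : Q *m Q^T = 1%:M -> jordan_star_automorphism (conjQ Q).
Proof.
move=> QQt; have QtQ : Q^T *m Q = 1%:M by apply: mulmx1C.
have mulQ x y : omulmx (rowact Q (colact Q x)) (rowact Q (colact Q y)) =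
    rowact Q (colact Q (omulmx x y)).
  by rewrite omulmx_rowact rowcolactC omulmx_colact omulmx_colrow rowactM QtQ
    rowact1.
split.
- move=> c x y; apply: c6P => i j; rewrite c6linE !conjQE.
  rewrite scaler_sumr -big_split; apply: eq_bigr => k _.
  rewrite scaler_sumr -big_split; apply: eq_bigr => l _.
  by rewrite c6linE scalerDr !scalerA mulrC.
- by exists (conjQ Q^T); apply: conjQK.
- move=> x y; apply: val_inj.
  rewrite -[LHS]/(c6mx _) -[RHS]/(oscalemx 2^-1 (omulmx (c6mx _) (c6mx _) +
    omulmx (c6mx _) (c6mx _))) !c6mx_conjQ.
  by rewrite !mulQ -[c6mx _]/(oscalemx _ (_ + _)) colactZ rowactZ colactD rowactD.
move=> x; apply: c6P => i j; rewrite c6starE !conjQE.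
rewrite (big_morph (@cdconj R 3) (@cdconjD R 3) (@cdconj0 R 3)).
apply: eq_bigr => k _.
rewrite (big_morph (@cdconj R 3) (@cdconjD R 3) (@cdconj0 R 3)).
apply: eq_bigr => l _.
by rewrite c6starE cdconjZ -rmorphM conjc_real.
Qed.

End OrthogonalAutomorphisms.

(** * Automorphisms preserving diagonal matrices *)

Section FrameAutomorphisms.
Variable R : realType.
Local Arguments cdmul : simpl never.
Local Arguments cddiam : simpl never.
Implicit Types (x y : C6 R) (T U : C6 R -> C6 R) (s : {perm 'I_3}).

Definition scalar_entry (z : octonion R) := exists c, z = c *: cd1 R 3.

Lemma scalar_diam z : scalar_entry z -> cddiam z = z.
Proof. by case=> c ->; rewrite cddiamZ cddiam1. Qed.

Lemma sqrN1_sandwich n c (u : CD R n) : cdmul u u = - cd1 R n ->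
  cdmul u (cdmul (c *: cd1 R n) u) = (- c) *: cd1 R n.
Proof.
by move=> uu; rewrite cdmulZl cdmul1l cdmulZr uu scalerN scaleNr.
Qed.

Lemma imag_sandwich u z : unit_imag u -> scalar_entry z ->
  scalar_entry (cdmul u (cdmul z u)).
Proof.
move=> /unit_imag_sqr uu [c ->]; exists (- c); exact: sqrN1_sandwich.
Qed.

Lemma cdmul2_scalar n c (a b : CD R n) :
  cdmul b (cdmul a (c *: cd1 R n)) = c *: cdmul b a.
Proof. by rewrite !cdmulZr cdmul1r. Qed.

Lemma conj_permE s x i j :
  c6mx (conjQ (perm_mx s) x) i j = c6mx x (s i) (s j).
Proof.
have pE k l : (perm_mx s : 'M[R]_3) k l = (s k == l)%:R by rewrite !mxE.
rewrite conjQE (bigD1 (s i)) //= [X in _ + X]big1 ?addr0 => [|k neq].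
  rewrite (bigD1 (s j)) //= big1 ?addr0 => [|l neq].
    by rewrite !pE !eqxx mulr1 scale1r.
  by rewrite !pE [s j == l]eq_sym (negPf neq) rmorph0 mulr0 scale0r.
rewrite big1 // => l _.
by rewrite !pE [s i == k]eq_sym (negPf neq) rmorph0 mul0r scale0r.
Qed.

Lemma conj_perm_jaut s : jordan_star_automorphism (conjQ (perm_mx s) : C6 R -> _).
Proof. by apply: conjQ_jaut; rewrite tr_perm_mx -perm_mxM mulgV perm_mx1. Qed.

(** The automorphisms that may still be applied once [e] has been made diagonal. *)
Definition frame_aut T := jordan_star_automorphism T /\
  forall x, is_diag_mx (c6mx x) -> is_diag_mx (c6mx (T x)).

Lemma frame_aut_comp T U : frame_aut T -> frame_aut U -> frame_aut (T \o U).
Proof.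
move=> [aT dT] [aU dU]; split=> [|x dx /=]; first exact: jaut_comp.
exact/dT/dU.
Qed.

Lemma frame_perm s : frame_aut (conjQ (perm_mx s)).
Proof.
split=> [|x /is_diag_mxP dx]; first exact: conj_perm_jaut.
apply/is_diag_mxP => i j neq; rewrite conj_permE dx //.
by apply: contra neq => /eqP/val_inj/perm_inj ->.
Qed.

Lemma diag_upperP x : reflect
  [/\ c6mx x i0 i1 = 0, c6mx x i1 i2 = 0 & c6mx x i0 i2 = 0]
  (is_diag_mx (c6mx x)).
Proof.
apply: (iffP is_diag_mxP) => [dx | [e01 e12 e02]]; first by split; apply: dx.
elim/ord3P; elim/ord3P => // _; rewrite -cddiam_c6.
- by rewrite e01 cddiam0.
- by rewrite e02 cddiam0.
by rewrite e12 cddiam0.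
Qed.

Lemma frame_spin a : unit_real a -> frame_aut (spin a).
Proof.
move=> ua; split=> [|x /diag_upperP[e01 e12 e02]]; first exact: spin_jaut.
apply/diag_upperP; rewrite spin01E spin12E spin02E e01 e12 e02.
by rewrite !cdmul0l !cdmul0r.
Qed.

Lemma real_entry x i j : c6star x = x -> cdconj (c6mx x i j) = c6mx x i j.
Proof. by move=> rx; rewrite -c6starE rx. Qed.

Lemma jaut_real T x : jordan_star_automorphism T -> c6star x = x ->
  c6star (T x) = T x.
Proof. by move=> [_ _ _ sT] rx; rewrite -sT rx. Qed.

Definition swap12 : C6 R -> C6 R := conjQ (perm_mx (tperm i1 i2)).
Definition swap01 : C6 R -> C6 R := conjQ (perm_mx (tperm i0 i1)).

Lemma swap12E x : [/\ c6mx (swap12 x) i0 i1 = c6mx x i0 i2,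
  c6mx (swap12 x) i1 i2 = cddiam (c6mx x i1 i2)
  & c6mx (swap12 x) i0 i2 = c6mx x i0 i1].
Proof.
by rewrite /swap12 !conj_permE tpermL tpermR tpermD // cddiam_c6.
Qed.

Lemma swap01E x : [/\ c6mx (swap01 x) i0 i1 = cddiam (c6mx x i0 i1),
  c6mx (swap01 x) i1 i2 = c6mx x i0 i2
  & c6mx (swap01 x) i0 i2 = c6mx x i1 i2].
Proof.
by rewrite /swap01 !conj_permE tpermL tpermR tpermD // cddiam_c6.
Qed.

(** One spin makes the (1,2) entry scalar, and a swap parks it at (1,3). Two imaginary spins then
    make the new (1,2) entry scalar, while the parked one only changes sign. The last clause lets
    the lemma be applied a second time in [diagonalize_real] without losing a zero at (2,3). *)
Lemma scalar_first_row x : c6star x = x -> exists T, [/\ frame_aut T,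
  scalar_entry (c6mx (T x) i0 i1), scalar_entry (c6mx (T x) i0 i2)
  & c6mx x i1 i2 = 0 -> c6mx (T x) i1 i2 = 0].
Proof.
move=> rx.
have [a0 [ua0 [c e1]]] := make_scalar_left (real_entry i0 i1 rx).
have ry : cdconj (c6mx (spin a0 x) i0 i2) = c6mx (spin a0 x) i0 i2.
  by apply: real_entry; apply: jaut_real rx; apply: spin_jaut.
have [a [b [ua ub [d e2]]]] := make_scalar_imag ry.
have [s01 s12 s02] := swap12E (spin a0 x).
exists (spin b \o (spin a \o (swap12 \o spin a0))); split.
- apply: frame_aut_comp; first exact: frame_spin ub.1.
  apply: frame_aut_comp; first exact: frame_spin ua.1.
  by apply: frame_aut_comp; [exact: frame_perm | exact: frame_spin].
- by exists d; rewrite /= !spin01E s01.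
- rewrite /= !spin02E s02 spin01E.
  by apply: (imag_sandwich ub); apply: (imag_sandwich ua); exists c; exact: e1.
move=> e12; rewrite /= !spin12E s12 spin12E e12.
by rewrite !cdmul0l cddiam0 !cdmul0l.
Qed.

(** Once the first row is scalar, the two spins of [make_biquaternion] bring (1,2) and (2,3) into H;
    the (1,3) entry changes sign twice and the diagonal is scalar. *)
Lemma biquaternion_entries x : c6star x = x -> exists T, frame_aut T /\
  forall i j, (c6mx (T x) i j).2 = 0.
Proof.
move=> rx; have [T [fT [p e01] [q e02] _]] := scalar_first_row rx.
have rTx : c6star (T x) = T x by apply: jaut_real rx; case: fT.
have [a [b [ua ub ba wab]]] := make_biquaternion (real_entry i1 i2 rTx).
exists (spin b \o (spin a \o T)); split.
  apply: frame_aut_comp; first exact: frame_spin ub.1.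
  by apply: frame_aut_comp; first exact: frame_spin ua.1.
have scal0 z : scalar_entry z -> z.2 = 0.
  by move=> [c ->]; apply: (@cdscale_snd0 R 2).
have f01 : (c6mx ((spin b \o (spin a \o T)) x) i0 i1).2 = 0.
  rewrite /= !spin01E e01 (_ : cdmul _ _ = p *: cdmul b a).
    exact: (@cdscale_snd0 R 2).
  exact: cdmul2_scalar.
have f12 : (c6mx ((spin b \o (spin a \o T)) x) i1 i2).2 = 0.
  by rewrite /= !spin12E.
have f02 : (c6mx ((spin b \o (spin a \o T)) x) i0 i2).2 = 0.
  apply: scal0; rewrite /= !spin02E.
  by apply: (imag_sandwich ub); apply: (imag_sandwich ua); exists q.
have fd i : (c6mx ((spin b \o (spin a \o T)) x) i i).2 = 0.
  exact/scal0/c6_diagE.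
have dm (z : CD R 3) : z.2 = 0 -> (cddiam z).2 = 0.
  by move=> z0; rewrite -[LHS]/(- z.2) z0 oppr0.
elim/ord3P; elim/ord3P => //; rewrite -cddiam_c6; exact: dm.
Qed.

End FrameAutomorphisms.

(** * Diagonalization *)

Section RealMatrices.
Variable R : realType.
Implicit Types (p q r s t : R).

(* Reflection in the bisector of [v] and the first basis vector. *)
Lemma orthogonal_first_row (v : 'rV[R]_3) : \sum_i v 0 i * v 0 i = 1 ->
  exists Q : 'M[R]_3, Q *m Q^T = 1%:M /\ row i0 Q = v.
Proof.
rewrite sum3E => v1.
pose w0 := 1 - v 0 i0; pose w1 := - v 0 i1; pose w2 := - v 0 i2.
pose n := w0 * w0 + w1 * w1 + w2 * w2.
have n_def : n = 2 * w0.
  have -> : n = 1 - 2 * v 0 i0 + (v 0 i0 * v 0 i0 + v 0 i1 * v 0 i1 + v 0 i2 * v 0 i2).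
    by rewrite /n /w0 /w1 /w2; ring.
  by rewrite v1 /w0; ring.
have [/eqP n0|n0] := boolP (n == 0).
  exists 1%:M; split; first by rewrite trmx1 mulmx1.
  move/eqP: n0; rewrite /n -!expr2 paddr_eq0 ?addr_ge0 ?sqr_ge0 //.
  rewrite paddr_eq0 ?sqr_ge0 // !sqrf_eq0 => /andP[/andP[/eqP e0 /eqP e1] /eqP e2].
  apply/rowP; elim/ord3P; rewrite !mxE /=.
  - by apply/eqP; rewrite -subr_eq0 -[1%:R]/1 -/w0 e0.
  - by apply/eqP; rewrite eq_sym -oppr_eq0 -/w1 e1.
  by apply/eqP; rewrite eq_sym -oppr_eq0 -/w2 e2.
pose w (i : 'I_3) := if val i is 0 then w0 else if val i is 1 then w1 else w2.
have w00 : w0 != 0 by apply: contraNneq n0 => w00; rewrite n_def w00 mulr0.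
(* Since |w|^2 = 2 w0, the Householder matrix 1 - 2 w w^T / |w|^2 is 1 - w w^T / w0. *)
exists (\matrix_(i, j) ((i == j)%:R - w i * w j / w0)); split.
  have n_def' : w1 * w1 = 2 * w0 - w0 * w0 - w2 * w2 by rewrite -n_def /n; ring.
  apply/matrixP; elim/ord3P; elim/ord3P; rewrite !mxE sum3E !mxE /w /=;
    by field: n_def'.
apply/rowP; elim/ord3P; rewrite !mxE /w /=.
- by rewrite /w0 in w00 *; field.
- by rewrite /w1 /w0 in w00 *; field.
by rewrite /w2 /w0 in w00 *; field.
Qed.

(** The characteristic polynomial has degree 3, so it has a real root; a left eigenvector is
    normalized and completed to an orthogonal matrix. *)
Lemma orthogonal_eigenrow (B : 'M[R]_3) : exists (Q : 'M[R]_3) (l : R),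
  Q *m Q^T = 1%:M /\ row i0 Q *m B = l *: row i0 Q.
Proof.
have [|l] := @odd_poly_root _ (char_poly B); first by rewrite size_char_poly.
rewrite -eigenvalue_root_char => /eigenvalueP[v vB v0].
pose n := \sum_i v 0 i ^+ 2.
have n_ge0 : 0 <= n by apply: sumr_ge0 => i _; apply: sqr_ge0.
have n0 : n != 0.
  apply: contraNneq v0 => /eqP; rewrite psumr_eq0 => [/allP vi|i _]; last exact: sqr_ge0.
  apply/eqP/rowP => i; rewrite mxE; apply/eqP.
  by rewrite -sqrf_eq0; apply: (vi i); rewrite mem_index_enum.
pose r := Num.sqrt n.
have r2 : r * r = n by rewrite -expr2 sqr_sqrtr.
have [|Q [QQ rowQ]] := @orthogonal_first_row (r^-1 *: v).
  under eq_bigr => i _ do rewrite mxE mulrACA -invfM r2 -expr2.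
  by rewrite -mulr_sumr mulVf.
exists Q, l; split=> //.
by rewrite rowQ -scalemxAl vB !scalerA mulrC.
Qed.

(** The Jacobi rotation that diagonalizes the symmetric matrix with diagonal (p, q) and off-diagonal
    entry r. The tangent t = s / c is a root of r t^2 + (p - q) t - r. *)
Lemma jacobi_angle p q r : exists c s : R, c * c + s * s = 1 /\
  (c * c - s * s) * r = c * s * (p - q).
Proof.
have [->|r0] := eqVneq r 0.
  by exists 1, 0; split; ring.
pose D := (p - q) ^+ 2 + (2 * r) ^+ 2.
have D0 : 0 <= D by rewrite addr_ge0 ?sqr_ge0.
pose t := (- (p - q) + Num.sqrt D) / (2 * r).
have tE : t * t * r = r - t * (p - q).
  have -> : t * t * r = (- (p - q) + Num.sqrt D) ^+ 2 / (4 * r).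
    by rewrite /t; field.
  by rewrite sqrrD sqr_sqrtr // /D /t; field.
have t1 : 0 < 1 + t ^+ 2 by rewrite ltr_pwDl ?ltr01 ?sqr_ge0.
pose k := Num.sqrt (1 + t ^+ 2).
have k2 : k * k = 1 + t ^+ 2 by rewrite -expr2 sqr_sqrtr // ltW.
have k0 : k != 0 by rewrite sqrtr_eq0 -ltNge.
exists k^-1, (t / k); split.
  transitivity ((1 + t ^+ 2) / (k * k)); first by field.
  by rewrite -k2 divff // mulf_neq0.
have -> : (k^-1 * k^-1 - t / k * (t / k)) * r = (r - t * t * r) / (k * k) by field.
by rewrite tE; field.
Qed.

Definition rot12_mx (c s : R) : 'M[R]_3 :=
  \matrix_(i, j) match val i, val j with
  | 0, 0 => 1 | 1, 1 => c | 1, 2 => s | 2, 1 => - s | 2, 2 => c | _, _ => 0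
  end.

Lemma rot12_orthogonal c s : c * c + s * s = 1 ->
  rot12_mx c s *m (rot12_mx c s)^T = 1%:M.
Proof.
move=> cs1; have c2 : c * c = 1 - s * s by rewrite -cs1 addrK.
by apply/matrixP; elim/ord3P; elim/ord3P; rewrite !mxE sum3E !mxE /=; ring: c2.
Qed.

End RealMatrices.

(** * Diagonalization of real elements *)

Section Diagonalization.
Variable R : realType.
Local Arguments cdmul : simpl never.
Local Arguments cddiam : simpl never.
Implicit Types (x y : C6 R) (T U : C6 R -> C6 R) (c s p q r : R).

Section RotationSums.
Variables (V : lmodType R[i]) (f : 'I_3 -> 'I_3 -> V) (c s : R).

(** The entries of a matrix conjugated by a rotation, over an abstract module: the computations then
    never meet octonion coordinates. *)
Definition rot12_sum i j :=
  \sum_k \sum_l ((rot12_mx c s i k)%:C * (rot12_mx c s j l)%:C) *: f k l.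

Lemma rot12_sumE i j : rot12_sum i j =
  let g k := (rot12_mx c s j i0)%:C *: f k i0 + (rot12_mx c s j i1)%:C *: f k i1
    + (rot12_mx c s j i2)%:C *: f k i2 in
  (rot12_mx c s i i0)%:C *: g i0 + (rot12_mx c s i i1)%:C *: g i1
    + (rot12_mx c s i i2)%:C *: g i2.
Proof.
by rewrite /rot12_sum sum3E !sum3E /= !scalerDr !scalerA.
Qed.

Let simp := (rmorph0 (real_complex R), rmorph1 (real_complex R),
  scale0r, scale1r, scaler0, add0r, addr0).

Lemma rot12_sum01 : rot12_sum i0 i1 = c%:C *: f i0 i1 + s%:C *: f i0 i2.
Proof. by rewrite rot12_sumE !mxE /= !simp. Qed.

Lemma rot12_sum02 : rot12_sum i0 i2 = (- s)%:C *: f i0 i1 + c%:C *: f i0 i2.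
Proof. by rewrite rot12_sumE !mxE /= !simp. Qed.

Lemma rot12_sum12_scalar u p q r : f i1 i1 = p%:C *: u -> f i1 i2 = r%:C *: u ->
  f i2 i1 = r%:C *: u -> f i2 i2 = q%:C *: u ->
  (c * c - s * s) * r = c * s * (p - q) -> rot12_sum i1 i2 = 0.
Proof.
move=> f11 f12 f21 f22 angle; rewrite rot12_sumE !mxE /= !simp f11 f12 f21 f22.
rewrite !scalerA -!rmorphM -!scalerDl !scalerA -scalerDl -!rmorphD -!rmorphM.
rewrite -rmorphD (_ : _ + _ = (c * c - s * s) * r - c * s * (p - q)); last by ring.
by rewrite angle subrr rmorph0 scale0r.
Qed.

(** A diagonal matrix that is constant on the rotated plane commutes with the rotation. *)
Lemma rot12_sum_fixed u v : c * c + s * s = 1 ->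
  (forall i j, f i j = if i == j then if val i is 0 then u else v else 0) ->
  forall i j, rot12_sum i j = f i j.
Proof.
move=> cs1 fE; have c2 : c * c = 1 - s * s by rewrite -cs1 addrK.
elim/ord3P; elim/ord3P; rewrite rot12_sumE !mxE /= !simp !fE /=;
  do ?[rewrite simp] => //.
- rewrite !scalerA -scalerDl -!rmorphM -rmorphD -[RHS]scale1r.
  by congr (_ *: _); rewrite -(rmorph1 (real_complex R)); congr (_%:C); ring: c2.
- rewrite !scalerA -scalerDl -!rmorphM -rmorphD -[RHS](scale0r v).
  by congr (_ *: _); rewrite -(rmorph0 (real_complex R)); congr (_%:C); ring.
- rewrite !scalerA -scalerDl -!rmorphM -rmorphD -[RHS](scale0r v).
  by congr (_ *: _); rewrite -(rmorph0 (real_complex R)); congr (_%:C); ring.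
rewrite !scalerA -scalerDl -!rmorphM -rmorphD -[RHS]scale1r.
by congr (_ *: _); rewrite -(rmorph1 (real_complex R)); congr (_%:C); ring: c2.
Qed.

End RotationSums.

Lemma conj_rot12E c s x i j : c6mx (conjQ (rot12_mx c s) x) i j =
  rot12_sum (c6mx x) c s i j.
Proof. exact: conjQE. Qed.

Lemma real_scalar (z : octonion R) : scalar_entry z -> cdconj z = z ->
  exists r : R, z = r%:C *: cd1 R 3.
Proof.
case=> k ->; rewrite cdconjZ cdconj1 => /eqP.
rewrite -subr_eq0 -scalerBl scaler_eq0 (negPf (cd1_neq0 R 3)) orbF subr_eq0.
case: k => a b /eqP[/eqP]; rewrite eq_sym -addr_eq0 -mulr2n mulrn_eq0 => /eqP->.
by exists a.
Qed.

Lemma real_scalar_entry x i j : c6star x = x -> scalar_entry (c6mx x i j) ->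
  exists r : R, c6mx x i j = r%:C *: cd1 R 3.
Proof. by move=> rx /real_scalar; apply; apply: real_entry. Qed.

Lemma real_diag_entry x i : c6star x = x ->
  exists r : R, c6mx x i i = r%:C *: cd1 R 3.
Proof. by move=> rx; apply: real_scalar_entry => //; apply: c6_diagE. Qed.

(** A spin makes the (2,3) entry scalar, and a Jacobi rotation kills it. Both maps fix the diagonal
    matrices with equal last two entries, which is what simultaneous diagonalization uses. *)
Lemma diagonalize_block x : c6star x = x ->
    c6mx x i0 i1 = 0 -> c6mx x i0 i2 = 0 ->
  exists T, [/\ jordan_star_automorphism T, is_diag_mx (c6mx (T x))
    & forall y, is_diag_mx (c6mx y) -> c6mx y i1 i1 = c6mx y i2 i2 -> T y = y].
Proof.
move=> rx e01 e02.
have [a [ua xa]] := make_scalar_right (real_entry i1 i2 rx).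
have aS := spin_jaut ua; have rSx := jaut_real aS rx.
have [p e11] := real_diag_entry i1 rSx; have [q e22] := real_diag_entry i2 rSx.
have [|r e12] := @real_scalar_entry (spin a x) i1 i2 rSx.
  by rewrite spin12E.
have [c [s [cs1 angle]]] := jacobi_angle p q r.
exists (conjQ (rot12_mx c s) \o spin a); split.
- by apply: jaut_comp => //; apply/conjQ_jaut/rot12_orthogonal.
- have f01 : c6mx (spin a x) i0 i1 = 0 by rewrite spin01E e01 cdmul0r.
  have f02 : c6mx (spin a x) i0 i2 = 0.
    by rewrite spin02E e02 cdmul0l cdmul0r.
  apply/diag_upperP; split; rewrite [LHS]conj_rot12E.
  + by rewrite rot12_sum01 f01 f02 !scaler0 addr0.
  + apply: (rot12_sum12_scalar e11 e12 _ e22 angle).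
    apply: etrans (esym (cddiam_c6 _ _ _)) _.
    exact: etrans (scalar_diam (ex_intro _ _ e12)) e12.
  by rewrite rot12_sum02 f01 f02 !scaler0 addr0.
move=> y /diag_upperP[y01 y12 y02] y11.
have -> : (conjQ (rot12_mx c s) \o spin a) y = conjQ (rot12_mx c s) (spin a y).
  by [].
have -> : spin a y = y.
  apply: c6_upperP; rewrite ?spin_diagE ?spin01E ?spin12E ?spin02E //.
  - by rewrite y01 cdmul0r.
  - by rewrite y12 cdmul0l.
  by rewrite y02 cdmul0l cdmul0r.
apply: c6P => i j; rewrite conj_rot12E.
apply: (rot12_sum_fixed (u := c6mx y i0 i0) (v := c6mx y i1 i1)) => //.
by elim/ord3P; elim/ord3P => //=; rewrite -cddiam_c6 ?y01 ?y12 ?y02 ?cddiam0.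
Qed.

Lemma conj_sum_scalar (V : lmodType R[i]) (u : V) (Q B : 'M[R]_3) i j :
  \sum_k \sum_l ((Q i k)%:C * (Q j l)%:C) *: ((B k l)%:C *: u) =
  ((row i Q *m B *m (row j Q)^T) 0 0)%:C *: u.
Proof.
rewrite mxE rmorph_sum scaler_suml exchange_big /=; apply: eq_bigr => m _.
rewrite !mxE mulr_suml rmorph_sum scaler_suml; apply: eq_bigr => k _.
by rewrite scalerA !mxE -!rmorphM mulrAC.
Qed.

Lemma diagonalize_real x : c6star x = x ->
  exists T, jordan_star_automorphism T /\ is_diag_mx (c6mx (T x)).
Proof.
move=> rx.
have [T1 [[aT1 _] s01 s02 _]] := scalar_first_row rx.
have r1 := jaut_real aT1 rx.
have [p e01] := real_scalar_entry r1 s01.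
have [q e02] := real_scalar_entry r1 s02.
have [s [t [st1 st0]]] := unit_orthogonal p q.
set y := T1 x in r1 e01 e02 *.
(* This rotation turns the (1,3) entry into s p + t q = 0. *)
have aQ : jordan_star_automorphism (conjQ (rot12_mx t (- s))).
  by apply/conjQ_jaut/rot12_orthogonal; rewrite mulrNN addrC.
set z := conjQ (rot12_mx t (- s)) y.
have z02 : c6mx z i0 i2 = 0.
  rewrite conj_rot12E rot12_sum02 e01 e02 opprK !scalerA -scalerDl.
  by rewrite -!rmorphM -rmorphD st0 rmorph0 scale0r.
(* Exchanging the first two indices moves the zero to (2,3). A second pass makes the first row
   scalar and keeps this zero, so every entry becomes a real scalar. *)
have [aS _] := frame_perm R (tperm i0 i1).
have rz := jaut_real aS (jaut_real aQ r1).
have [_ w12 _] := swap01E z.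
have [T2 [[aT2 _] s01' s02' s12']] := scalar_first_row rz.
have rw := jaut_real aT2 rz.
set w := T2 _ in s01' s02' s12' rw.
have {}s12' : c6mx w i1 i2 = 0 by apply: s12'; rewrite w12.
have scal i j : exists b : R, c6mx w i j = b%:C *: cd1 R 3.
  apply: (real_scalar_entry rw); move: i j.
  have s12 : scalar_entry (c6mx w i1 i2) by exists 0; rewrite s12' scale0r.
  elim/ord3P; elim/ord3P => //; try exact: c6_diagE;
    by rewrite -cddiam_c6 scalar_diam.
have [B wB] : exists B : 'M[R]_3, forall i j, c6mx w i j = (B i j)%:C *: cd1 R 3.
  have [f fE] := fin_all_exists (fun i => fin_all_exists (scal i)).
  exists (\matrix_(i, j) f i j) => i j; apply: etrans (fE i j) _.
  by congr (_%:C *: _); rewrite mxE.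
have [Q [l [QQ QB]]] := orthogonal_eigenrow B.
have aQ' := conjQ_jaut QQ.
(* The first row of Q is an eigenrow of B, so the first row of Q B Q^T is l times that of Q Q^T = 1.
   Only the lower 2 by 2 block is left to diagonalize. *)
have row0 j : j != i0 -> c6mx (conjQ Q w) i0 j = 0.
  move=> j0; rewrite conjQE.
  transitivity (((row i0 Q *m B *m (row j Q)^T) 0 0)%:C *: cd1 R 3).
    rewrite -conj_sum_scalar; apply: eq_bigr => k _; apply: eq_bigr => m _.
    by rewrite wB.
  have -> : (row i0 Q *m B *m (row j Q)^T) 0 0 = l * (Q *m Q^T) i0 j.
    rewrite QB -scalemxAl !mxE mulr_sumr mulr_sumr; apply: eq_bigr => k _.
    by rewrite !mxE.
  by rewrite QQ mxE eq_sym (negPf j0) mulr0 rmorph0 scale0r.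
have [|||T3 [aT3 dT3 _]] := @diagonalize_block (conjQ Q w).
- exact: jaut_real rw.
- exact: row0.
- exact: row0.
exists (T3 \o (conjQ Q \o (T2 \o (swap01 (R:=R) \o (conjQ (rot12_mx t (- s)) \o T1))))).
by split=> //; do ![apply: jaut_comp => //].
Qed.

End Diagonalization.

(** * Diagonal elements, operator commutation and unitaries *)

Section DiagonalMatrices.
Variable R : realType.
Local Arguments cddiam : simpl never.
Implicit Types (f : 'I_3 -> R[i]).

Lemma c6diag_subproof f :
  odiam (\matrix_(i, j) if i == j then f i *: cd1 R 3 else 0) ==
  \matrix_(i, j) if i == j then f i *: cd1 R 3 else 0.
Proof.
apply/eqP/matrixP => i j; rewrite odiamE !mxE eq_sym.
case: eqP => [->|_]; last exact: cddiam0.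
by apply: scalar_diam; exists (f j).
Qed.

End DiagonalMatrices.

HB.lock Definition c6diag (R : realType) (f : 'I_3 -> R[i]) : C6 R :=
  MkC6 (c6diag_subproof f).

Section DiagonalElements.
Variable R : realType.
Local Arguments cdmul : simpl never.
Local Arguments cddiam : simpl never.
Implicit Types (x y z a b u : C6 R) (T U : C6 R -> C6 R) (f g : 'I_3 -> R[i]).

Lemma c6diagE f i j :
  c6mx (c6diag f) i j = if i == j then f i *: cd1 R 3 else 0.
Proof. by rewrite c6diag.unlock; apply: mxE. Qed.

Lemma eq_c6diag f g : f =1 g -> c6diag f = c6diag g.
Proof.
move=> fg; apply: c6P => i j; apply: etrans (c6diagE _ _ _) _.
by apply: etrans _ (esym (c6diagE _ _ _)); rewrite fg.
Qed.

Lemma is_diag_c6diag f : is_diag_mx (c6mx (c6diag f)).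
Proof. by apply/is_diag_mxP => i j neq; rewrite c6diagE -val_eqE /= (negPf neq). Qed.

Lemma diag_c6E x : is_diag_mx (c6mx x) -> exists f, x = c6diag f.
Proof.
move=> dx; have [f fE] := fin_all_exists (c6_diagE x).
exists f; apply: c6P => i j; apply: etrans _ (esym (c6diagE _ _ _)).
by case: eqP => [<-|/eqP neq]; [exact: fE | exact: is_diag_mxP dx _ _ neq].
Qed.

Lemma cdmul_diag_suml n (F : 'I_3 -> CD R n) (f : 'I_3 -> R[i]) i :
  \sum_k cdmul (if i == k then f i *: cd1 R n else 0) (F k) = f i *: F i.
Proof.
rewrite (bigD1 i) //= eqxx cdmulZl cdmul1l big1 ?addr0 // => k neq.
by rewrite eq_sym (negPf neq) cdmul0l.
Qed.

Lemma cdmul_diag_sumr n (F : 'I_3 -> CD R n) (f : 'I_3 -> R[i]) j :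
  \sum_k cdmul (F k) (if k == j then f k *: cd1 R n else 0) = f j *: F j.
Proof.
rewrite (bigD1 j) //= eqxx cdmulZr cdmul1r big1 ?addr0 // => k neq.
by rewrite (negPf neq) cdmul0r.
Qed.

Lemma c6jordanE x y i j : c6mx (c6jordan x y) i j =
  2^-1 *: (\sum_k cdmul (c6mx x i k) (c6mx y k j) +
           \sum_k cdmul (c6mx y i k) (c6mx x k j)).
Proof. exact: ojordanE. Qed.

(** The positions (i, j) are the Peirce spaces of the diagonal frame, on which multiplication by a
    diagonal element acts as a scalar. *)
Lemma jordan_diagE f x i j :
  c6mx (c6jordan (c6diag f) x) i j = (2^-1 * (f i + f j)) *: c6mx x i j.
Proof.
apply: etrans (c6jordanE _ _ _ _) _; rewrite -scalerA scalerDl.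
congr (_ *: (_ + _)).
  rewrite -(cdmul_diag_suml (fun k => c6mx x k j)).
  by apply: eq_bigr => k _; rewrite c6diagE.
rewrite -(cdmul_diag_sumr (fun k => c6mx x i k)).
by apply: eq_bigr => k _; rewrite c6diagE.
Qed.

Lemma half_double (c : R[i]) : 2^-1 * (c + c) = c.
Proof. by rewrite -mulr2n -[c *+ 2]mulr_natl mulrA mulVf ?mul1r ?pnatr_eq0. Qed.

Lemma jordan_diag f g : c6jordan (c6diag f) (c6diag g) = c6diag (fun i => f i * g i).
Proof.
apply: c6P => i j; apply: etrans (jordan_diagE _ _ _ _) _.
rewrite !c6diagE; case: eqP => [->|_]; last by rewrite scaler0.
by rewrite half_double scalerA.
Qed.

Lemma c6jordanC x y : c6jordan x y = c6jordan y x.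
Proof.
apply: c6P => i j; apply: etrans (c6jordanE _ _ _ _) _.
by apply: etrans _ (esym (c6jordanE _ _ _ _)); rewrite addrC.
Qed.

Lemma cdmul_sum_linl n (F G H : 'I_3 -> CD R n) (c : R[i]) :
  \sum_k cdmul (c *: F k + G k) (H k) =
  c *: \sum_k cdmul (F k) (H k) + \sum_k cdmul (G k) (H k).
Proof.
rewrite scaler_sumr -big_split; apply: eq_bigr => k _.
by rewrite cdmulDl cdmulZl.
Qed.

Lemma cdmul_sum_linr n (F G H : 'I_3 -> CD R n) (c : R[i]) :
  \sum_k cdmul (H k) (c *: F k + G k) =
  c *: \sum_k cdmul (H k) (F k) + \sum_k cdmul (H k) (G k).
Proof.
rewrite scaler_sumr -big_split; apply: eq_bigr => k _.
by rewrite cdmulDr cdmulZr.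
Qed.

Lemma scale_pair_lin (V : lmodType R[i]) (c d : R[i]) (p q r s : V) :
  d *: (c *: p + q + (c *: r + s)) = c *: (d *: (p + r)) + d *: (q + s).
Proof.
rewrite addrACA -scalerDr [LHS]scalerDr; congr (_ + _).
by rewrite !scalerA mulrC.
Qed.

Lemma c6jordan_lin c x y z :
  c6jordan z (c *: x + y) = c *: c6jordan z x + c6jordan z y.
Proof.
apply: c6P => i j; apply: etrans (c6jordanE _ _ _ _) _.
apply: etrans _ (esym (c6linE _ _ _ _ _)).
apply: etrans _ (esym (congr2 (fun s t => c *: s + t) (c6jordanE _ _ _ _)
  (c6jordanE _ _ _ _))).
apply: etrans _ (scale_pair_lin _ _ _ _ _ _).
apply: (congr2 (fun s t => 2^-1 *: (s + t))).
  apply: etrans _ (cdmul_sum_linr (fun k => c6mx x k j) (fun k => c6mx y k j)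
    (fun k => c6mx z i k) c).
  by apply: eq_bigr => k _; apply: congr1; apply: c6linE.
apply: etrans _ (cdmul_sum_linl (fun k => c6mx x i k) (fun k => c6mx y i k)
  (fun k => c6mx z k j) c).
by apply: eq_bigr => k _; apply: (congr1 (fun s => cdmul s _)); apply: c6linE.
Qed.

Lemma c6jordanDr x y z : c6jordan z (x + y) = c6jordan z x + c6jordan z y.
Proof. by have := c6jordan_lin 1 x y z; rewrite !scale1r. Qed.

Lemma c6jordanZr c x z : c6jordan z (c *: x) = c *: c6jordan z x.
Proof.
have z0 : c6jordan z 0 = 0.
  by apply: (addIr (c6jordan z 0)); rewrite -c6jordanDr !add0r.
by have := c6jordan_lin c x 0 z; rewrite z0 !addr0.
Qed.

Lemma c6jordanDl x y z : c6jordan (x + y) z = c6jordan x z + c6jordan y z.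
Proof. by rewrite c6jordanC c6jordanDr !(c6jordanC z). Qed.

Lemma c6jordanZl c x z : c6jordan (c *: x) z = c *: c6jordan x z.
Proof. by rewrite c6jordanC c6jordanZr !(c6jordanC z). Qed.

Definition c6one : C6 R := c6diag (fun=> 1).

Lemma c6jordan1l x : c6jordan c6one x = x.
Proof.
apply: c6P => i j; apply: etrans (jordan_diagE _ _ _ _) _.
by rewrite half_double scale1r.
Qed.

Lemma c6jordan1r x : c6jordan x c6one = x.
Proof. by rewrite c6jordanC c6jordan1l. Qed.

Lemma jaut1 T : jordan_star_automorphism T -> T c6one = c6one.
Proof.
case=> _ [U _ UK] jT _.
by rewrite -[LHS]c6jordan1r -{2}[c6one]UK -jT c6jordan1l UK.
Qed.

Lemma c6diag_const c : c6diag (fun=> c) = c *: c6one.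
Proof.
apply: c6P => i j; apply: etrans (c6diagE _ _ _) _.
apply: etrans _ (esym (c6scaleE _ _ _ _)); rewrite c6diagE.
by case: eqP => _; rewrite ?scaler0 // scale1r.
Qed.

Lemma conj_perm_diag (s : {perm 'I_3}) f :
  conjQ (perm_mx s) (c6diag f) = c6diag (f \o s).
Proof.
apply: c6P => i j; apply: etrans (conj_permE _ _ _ _) _.
by rewrite !c6diagE (inj_eq perm_inj).
Qed.

(** Operator commutation [L_a, L_b] = 0, the useful notion in a Jordan algebra, whose product is
    always commutative. *)
Definition jcommute a b :=
  forall x, c6jordan a (c6jordan b x) = c6jordan b (c6jordan a x).

Lemma jcommuteC a b : jcommute a b -> jcommute b a.
Proof. by move=> ab x; rewrite ab. Qed.

Lemma jcommuteD a b z : jcommute a b -> jcommute a z -> jcommute a (b + z).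
Proof. by move=> ab az x; rewrite !c6jordanDl c6jordanDr ab az. Qed.

Lemma jcommuteZ a b c : jcommute a b -> jcommute a (c *: b).
Proof. by move=> ab x; rewrite !c6jordanZl c6jordanZr ab. Qed.

Lemma jcommute_jaut T a b : jordan_star_automorphism T -> jcommute a b ->
  jcommute (T a) (T b).
Proof.
case=> _ [U _ UK] jT _ ab x.
by rewrite -(UK x) -!jT ab.
Qed.

(** Testing the commutation on the i-th diagonal idempotent and reading the (i, j) entry gives (f j
    - f i) / 4 times b_ij equal to 0. *)
Lemma jcommute_diag0 f b i j : jcommute (c6diag f) b -> f i != f j ->
  c6mx b i j = 0.
Proof.
move=> fb fij; have ij : i != j by apply: contraNneq fij => ->.
pose e k : R[i] := (k == i)%:R.
have /(congr1 (fun x => c6mx x i j)) := fb (c6diag e).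
rewrite jordan_diag [c6jordan b _]c6jordanC [c6jordan b _]c6jordanC.
move=> E; have {E} := etrans (esym (jordan_diagE _ _ _ _))
  (etrans E (jordan_diagE _ _ _ _)).
rewrite jordan_diagE /e eqxx eq_sym (negPf ij) !mulr0 mulr1 !addr0 mulr1 scalerA.
move/eqP; rewrite -subr_eq0 -scalerBl scaler_eq0 => /orP[|/eqP//].
rewrite -mulrA -mulrBr mulf_eq0 invr_eq0 pnatr_eq0 /=.
rewrite (_ : _ - _ = 2^-1 * (f j - f i)); last by field.
by rewrite mulf_eq0 invr_eq0 pnatr_eq0 /= subr_eq0 eq_sym (negPf fij).
Qed.

(** If all values of [f] agree, the diagonal element is a multiple of 1 and any diagonalization of
    [b] serves. Otherwise commutation makes [b] a block matrix, and [diagonalize_block] fixes the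
    diagonal element. *)
Lemma codiagonalize_eq12 f b : f i1 = f i2 -> c6star b = b ->
    jcommute (c6diag f) b ->
  exists T, [/\ jordan_star_automorphism T, is_diag_mx (c6mx (T (c6diag f)))
    & is_diag_mx (c6mx (T b))].
Proof.
move=> f12 rb fb; have [f01|f01] := eqVneq (f i0) (f i1).
  have [T [aT dT]] := diagonalize_real rb.
  exists T; split; [exact: aT | | exact: dT].
  have -> : c6diag f = c6diag (fun=> f i0).
    by apply: eq_c6diag; elim/ord3P; rewrite -?f12.
  by rewrite c6diag_const (jautZ _ _ aT) (jaut1 aT) -c6diag_const is_diag_c6diag.
have [||T [aT dT fixT]] := diagonalize_block rb.
- exact: jcommute_diag0 fb f01.
- by apply: jcommute_diag0 fb _; rewrite -f12.
exists T; split; [exact: aT | | exact: dT].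
rewrite fixT; [exact: is_diag_c6diag | exact: is_diag_c6diag |].
by rewrite !c6diagE !eqxx f12.
Qed.

(** First [a] is diagonalized. If two of its diagonal values coincide, a permutation moves them to
    the last two places; if all differ, commutation already forces [b] to be diagonal. *)
Lemma codiagonalize a b : c6star a = a -> c6star b = b -> jcommute a b ->
  exists T, [/\ jordan_star_automorphism T, is_diag_mx (c6mx (T a))
    & is_diag_mx (c6mx (T b))].
Proof.
move=> ra rb ab.
suff main f c : c6star c = c -> jcommute (c6diag f) c ->
    exists T, [/\ jordan_star_automorphism T,
      is_diag_mx (c6mx (T (c6diag f))) & is_diag_mx (c6mx (T c))].
  have [T [aT /diag_c6E[f Ta]]] := diagonalize_real ra.
  have [||U [aU dUa dUb]] := main f (T b).
  - exact: jaut_real rb.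
  - by rewrite -Ta; apply: jcommute_jaut.
  by exists (U \o T); split; [exact: jaut_comp | rewrite /= Ta |].
move=> rc fc.
have permuted (s : {perm 'I_3}) : f (s i1) = f (s i2) -> exists T,
    [/\ jordan_star_automorphism T, is_diag_mx (c6mx (T (c6diag f)))
      & is_diag_mx (c6mx (T c))].
  move=> fs; have aP := conj_perm_jaut R s.
  have [||T [aT dTf dTc]] := @codiagonalize_eq12 (f \o s) (conjQ (perm_mx s) c) fs.
  - exact: jaut_real rc.
  - by rewrite -conj_perm_diag; apply: jcommute_jaut.
  exists (T \o conjQ (perm_mx s)).
  by split; [exact: jaut_comp | rewrite /= conj_perm_diag |].
have [f12|f12] := eqVneq (f i1) (f i2).
  exact: codiagonalize_eq12.
have [f01|f01] := eqVneq (f i0) (f i1).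
  by apply: (permuted (tperm i0 i2)); rewrite tpermR tpermD.
have [f02|f02] := eqVneq (f i0) (f i2).
  by apply: (permuted (tperm i0 i1)); rewrite tpermR tpermD.
exists id; split; [exact: jaut_id | exact: is_diag_c6diag |].
by apply/diag_upperP; split; apply: jcommute_diag0 fc _.
Qed.

Lemma unitary_diagonalize u : c6unitary u ->
  exists T, jordan_star_automorphism T /\ is_diag_mx (c6mx (T u)).
Proof.
move=> hu; set v := c6star u.
have vK : c6star v = u by apply: c6P => i j; rewrite !c6starE cdconjK.
(* Unitarity evaluated at the unit element. *)
have uv1 : c6jordan u v = c6one.
  have := hu c6one; rewrite /c6triple c6jordan1l !c6jordan1r -/v.
  by rewrite [c6jordan v u]c6jordanC addrK.
(* As u ∘ u^* = 1, the first term of the triple product {u,u,x} is x; the other two must cancel,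
   which is [L_u, L_{u^*}] = 0. *)
have uv : jcommute u v.
  move=> x; have := hu x; rewrite /c6triple -/v uv1 c6jordan1l => /eqP.
  rewrite -addrA -[X in _ == X]addr0 (inj_eq (addrI x)) subr_eq0 => /eqP.
  by rewrite ![c6jordan _ u]c6jordanC ![c6jordan _ v]c6jordanC.
have starD x y : c6star (x + y) = c6star x + c6star y.
  apply: c6P => i j; rewrite c6starE c6D omxD cdconjD -!c6starE.
  by rewrite c6D omxD.
have starZ c x : c6star (c *: x) = conjc c *: c6star x.
  apply: c6P => i j; rewrite c6starE [in RHS]c6scaleE c6starE -cdconjZ.
  by congr cdconj; apply: c6scaleE.
pose ii : R[i] := 0 +i* 1.
have conj_ii : conjc ii = - ii by apply/eqP; rewrite eq_complex /= oppr0 !eqxx.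
have ii2 : ii * ii = -1.
  by apply/eqP; rewrite eq_complex /= !(mul0r, mulr0, mul1r, add0r, oppr0) !eqxx.
(* Up to the factor 2 and a sign, the real and imaginary parts of [u]: u = (a - i b) / 2, with a and
   b real. *)
pose a := u + v; pose b := ii *: (u + (-1) *: v).
have conjN1 : conjc (-1 : R[i]) = -1 by rewrite rmorphN rmorph1.
have [|||T [aT dTa dTb]] := @codiagonalize a b.
- by rewrite /a starD vK addrC.
- rewrite /b starZ starD starZ vK conjN1 conj_ii scalerDr scalerA mulrN1 opprK addrC.
  by rewrite scalerDr scalerA mulrN1.
- have uu : jcommute u u by [].
  have vv : jcommute v v by [].
  apply: jcommuteZ; apply: jcommuteD.
    by apply/jcommuteC/jcommuteD => //; apply: jcommuteC.
  by apply: jcommuteZ; apply/jcommuteC/jcommuteD => //; apply: jcommuteC.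
exists T; split; first exact: aT.
have -> : u = 2^-1 *: (a + (- ii) *: b).
  rewrite /a /b scalerA mulNr ii2 opprK scale1r scaleN1r.
  rewrite addrACA subrr addr0 scalerDr -scalerDl.
  by rewrite (_ : _ + _ = 1) ?scale1r //; field.
rewrite (jautZ _ _ aT) (jautD _ _ aT) (jautZ _ _ aT).
apply/is_diag_mxP => i j ij; apply: etrans (c6scaleE _ _ _ _) _.
rewrite c6D omxD (is_diag_mxP dTa _ _ ij).
rewrite (_ : c6mx (- ii *: T b) i j = 0) ?addr0 ?scaler0 //.
by apply: etrans (c6scaleE _ _ _ _) _; rewrite (is_diag_mxP dTb _ _ ij) scaler0.
Qed.

End DiagonalElements.

(** * Unitaries as polynomials in a real element, and the conclusion *)

Section Assembly.
Variable R : realType.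
Implicit Types (x y : C6 R).

Definition biquaternion_mx x := forall i j, (c6mx x i j).2 = 0.

Lemma biquaternion_lin (c : R[i]) x y : biquaternion_mx x -> biquaternion_mx y ->
  biquaternion_mx (c *: x + y).
Proof.
move=> hx hy i j; rewrite c6linE -[LHS]/(c *: (c6mx x i j).2 + (c6mx y i j).2).
by rewrite hx hy scaler0 addr0.
Qed.

Lemma biquaternion_jordan x y : biquaternion_mx x -> biquaternion_mx y ->
  biquaternion_mx (c6jordan x y).
Proof.
move=> hx hy i j; rewrite c6jordan3E; apply: (@cdscale_snd0 R 2).
have addr_snd0 (p q : CD R 3) : p.2 = 0 -> q.2 = 0 -> (p + q).2 = 0.
  by move=> p0 q0; rewrite -[LHS]/(p.2 + q.2) p0 q0 addr0.
have mul_snd0 k l : (cdmul (c6mx x i k) (c6mx y l j)).2 = 0 /\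
    (cdmul (c6mx y i k) (c6mx x l j)).2 = 0.
  by split; [apply: (@cdmul_snd0 R 2 _ _ (hx _ _) (hy _ _)) |
    apply: (@cdmul_snd0 R 2 _ _ (hy _ _) (hx _ _))].
apply: (addr_snd0 _ _ (addr_snd0 _ _ (addr_snd0 _ _ (mul_snd0 _ _).1
  (mul_snd0 _ _).1) (mul_snd0 _ _).1)).
exact: (addr_snd0 _ _ (addr_snd0 _ _ (mul_snd0 _ _).2 (mul_snd0 _ _).2)
  (mul_snd0 _ _).2).
Qed.

Lemma biquaternion_one : biquaternion_mx (c6one R).
Proof.
move=> i j; rewrite c6diagE; case: eqP => // _; exact: (@cdscale_snd0 R 2).
Qed.

Lemma scale_sum3 (V : lmodType R[i]) (v : V) (a b c p q r : R[i]) :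
  a *: (p *: v) + (b *: (q *: v) + c *: (r *: v)) = (a * p + (b * q + c * r)) *: v.
Proof. by rewrite !scalerA -!scalerDl. Qed.

(** By interpolation every diagonal matrix is a quadratic polynomial in the real element diag(0, 1,
    -1); the inverse of the diagonalizing automorphism transports this to [u]. It suffices then to
    move the real element [h], to which [biquaternion_entries] applies. *)
Lemma unitary_polynomial (u : C6 R) : c6unitary u -> exists h a b c,
  c6star h = h /\ u = a *: c6one R + (b *: h + c *: c6jordan h h).
Proof.
move=> /unitary_diagonalize[T [aT /diag_c6E[f Tu]]].
have [U [aU TU UT]] := jaut_inv aT.
pose d := c6diag (fun i : 'I_3 => if val i is 0 then 0 else
  if val i is 1 then 1 else -1 : R[i]).
have rd : c6star d = d.
  apply: c6P => i j; apply: etrans (c6starE _ _ _) _; rewrite !c6diagE.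
  case: eqP => _; last exact: cdconj0.
  rewrite cdconjZ cdconj1; congr (_ *: _).
  elim/ord3P: i; [exact: (rmorph0 (@conjc R)) | exact: (rmorph1 (@conjc R)) |].
  exact: (rmorphN1 (@conjc R)).
(* The coefficients of the quadratic interpolating [f] at the nodes 0, 1, -1. *)
exists (U d), (f i0), ((f i1 - f i2) / 2), ((f i1 + f i2) / 2 - f i0).
split; first exact: jaut_real rd.
have jU : c6jordan (U d) (U d) = U (c6jordan d d) by case: aU.
rewrite jU -{1}(jaut1 aU) -!(jautZ _ _ aU) -!(jautD _ _ aU) -[LHS]TU Tu.
congr U; rewrite jordan_diag; apply: c6P => i j.
rewrite !c6linE c6scaleE !c6diagE; case: eqP => _; last first.
  by rewrite !scaler0 !addr0.
rewrite scale_sum3; congr (_ *: _).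
by elim/ord3P: i => /=; field.
Qed.

End Assembly.

Theorem theorem4p5 (R : realType) (u e : C6 R) (hu : c6unitary u)
    (he : c6unitary e) :
  exists T : C6 R -> C6 R,
    [/\ jordan_star_automorphism T,
        is_diag_mx (c6mx (T e))
      & forall i j : 'I_3, is_biquaternion (c6mx (T u) i j)].
Proof.
have [Te [aTe dTe]] := unitary_diagonalize he.
have [h [a [b [c [rh ->]]]]] := unitary_polynomial hu.
(* [S] is chosen for the image of [h] and preserves diagonal matrices, so the image of [e] remains
   diagonal. *)
have [S [[aS dS] biq]] := biquaternion_entries (jaut_real aTe rh).
have aT := jaut_comp aS aTe.
exists (S \o Te); split; [exact: aT | exact: dS dTe |].
(* The image of [u] is the same polynomial in the image of [h], and matrices over H are closed under
   linear combinations and the Jordan product. *)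
have bTu : biquaternion_mx
    ((S \o Te) (a *: c6one R + (b *: h + c *: c6jordan h h))).
  case: (aT) => linT _ jT _; rewrite !linT (jautZ _ _ aT) jT (jaut1 aT).
  apply: biquaternion_lin; first exact: biquaternion_one.
  apply: biquaternion_lin; first exact: biq.
  have bhh : biquaternion_mx (c6jordan ((S \o Te) h) ((S \o Te) h)).
    by apply: biquaternion_jordan; apply: biq.
  rewrite -[c *: _]addr0; apply: biquaternion_lin; first exact: bhh.
  by move=> i j; rewrite omx0.
move=> i j; exists (c6mx ((S \o Te) (a *: c6one R + (b *: h + c *: c6jordan h h))) i j).1.
by apply: (etrans (surjective_pairing _)); congr pair; apply: bTu.
Qed.
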